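(* Let $N\in\mathbb N$, $\alpha,\beta>-1$, $\mu\in(0,1)$, let $\{x_j,\omega_j\}_{j=0}^N$ be the JGL nodes and weights, and let $\hat Q_0^\mu,\dots,\hat Q_N^\mu\in\mathcal P_N$ be defined by $$ {}^R\hat D_-^\mu\hat Q_0^\mu(x_i)=0\ (1\le i\le N),\ \ \hat Q_0^\mu(-1)=1;\qquad {}^R\hat D_-^\mu\hat Q_j^\mu(x_i)=\delta_{ij}\ (1\le i\le N),\ \ \hat Q_j^\mu(-1)=0\ (1\le j\le N). $$ Then for $0\le j\le N$, $$ \hat Q_j^\mu(x)=\zeta_j\sum_{l=0}^N\frac{\Gamma(l-\mu+1)}{l!}\,\hat t_{lj}\,P_l(x),\qquad \hat t_{lj}=\sum_{n=l}^N{}^{(\alpha,\beta)}C^{(\mu,-\mu)}_{ln}\,t_{nj},\qquad t_{nj}=\frac{\omega_j}{\tilde\gamma_n^{(\alpha,\beta)}}P_n^{(\alpha,\beta)}(x_j), $$ where $\zeta_0=1/\Gamma(1-\mu)$ and $\zeta_j=1$ for $1\le j\le N$.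
   Context: For $\rho>0$, $(I_-^\rho u)(x)=\frac{1}{\Gamma(\rho)}\int_{-1}^x (x-y)^{\rho-1}u(y)\,dy$; for $\mu\in(0,1)$, ${}^R D_-^\mu u=\frac{d}{dx}(I_-^{1-\mu}u)$ and ${}^R\hat D_-^\mu u=(1+x)^\mu\,{}^R D_-^\mu u$ (a polynomial when $u$ is a polynomial). Jacobi polynomials are in Szegő's normalization: $P_n^{(\alpha,\beta)}(x)=\frac{\Gamma(n+\alpha+1)}{n!\Gamma(\alpha+1)}\,{}_2F_1\big(-n,n+\alpha+\beta+1;\alpha+1;\tfrac{1-x}{2}\big)$, $P_0^{(\alpha,\beta)}=1$, $P_n=P_n^{(0,0)}$. For $\alpha,\beta>-1$, $\gamma_n^{(\alpha,\beta)}=\frac{2^{\alpha+\beta+1}\Gamma(n+\alpha+1)\Gamma(n+\beta+1)}{(2n+\alpha+\beta+1)\,n!\,\Gamma(n+\alpha+\beta+1)}$; $\tilde\gamma_n^{(\alpha,\beta)}=\gamma_n^{(\alpha,\beta)}$ for $n\le N-1$ and $\tilde\gamma_N^{(\alpha,\beta)}=\big(2+\frac{\alpha+\beta+1}{N}\big)\gamma_N^{(\alpha,\beta)}$. Connection coefficients: for $\alpha,\beta,a,b>-1$, ${}^{(\alpha,\beta)}C^{(a,b)}_{ln}$ are the unique numbers with $P_n^{(\alpha,\beta)}=\sum_{l=0}^n {}^{(\alpha,\beta)}C^{(a,b)}_{ln}P_l^{(a,b)}$. JGL nodes $x_0<\dots<x_N$ are the zeros of $(1-x^2)\frac{d}{dx}P_N^{(\alpha,\beta)}$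 ($x_0=-1$, $x_N=1$) and the weights $\omega_j$ make $\int_{-1}^1\phi(1-x)^\alpha(1+x)^\beta dx=\sum_j\phi(x_j)\omega_j$ exact for $\phi\in\mathcal P_{2N-1}$. *)

(* Defs.v *)
From Stdlib Require Import Reals Lra Arith ClassicalEpsilon.
Open Scope R_scope.

Fixpoint poch (a : R) (k : nat) : R :=
  match k with
  | O => 1
  | S k' => poch a k' * (a + INR k')
  end.

(* Gauss' product formula: Gamma(x) = lim n! n^x / (x (x+1) ... (x+n)),
   valid for every real x that is not a non-positive integer. *)
Definition gauss_seq (x : R) (n : nat) : R :=
  INR (fact n) * Rpower (INR n) x / poch x (S n).

Definition Gamma (x : R) : R :=
  epsilon (inhabits 0) (fun l => Un_cv (gauss_seq x) l).

(* Jacobi polynomial, Szego normalization, via 2F1. *)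
Definition Jacobi (a b : R) (n : nat) (x : R) : R :=
  Gamma (INR n + a + 1) / (INR (fact n) * Gamma (a + 1)) *
  sum_f_R0 (fun k => poch (- INR n) k * poch (INR n + a + b + 1) k
                       / (poch (a + 1) k * INR (fact k)) * ((1 - x) / 2) ^ k) n.

Definition Legendre (n : nat) (x : R) : R := Jacobi 0 0 n x.

Definition InPN (n : nat) (f : R -> R) : Prop :=
  exists c : nat -> R, forall x, f x = sum_f_R0 (fun k => c k * x ^ k) n.

Definition ImproperInt (f : R -> R) (a b L : R) : Prop :=
  forall eps, 0 < eps -> exists delta, 0 < delta /\
    forall c d, a < c -> c < a + delta -> b - delta < d -> d < b -> c < d ->
      exists pr : Riemann_integrable f c d, Rabs (RiemannInt pr - L) < eps.

Definition FracInt (rho : R) (u : R -> R) (x L : R) : Prop :=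
  exists I, ImproperInt (fun y => Rpower (x - y) (rho - 1) * u y) (-1) x I
            /\ L = I / Gamma rho.

Definition RLhatD (mu : R) (u : R -> R) (x d : R) : Prop :=
  exists F : R -> R,
    (forall y, -1 < y -> FracInt (1 - mu) u y (F y)) /\
    exists l, derivable_pt_lim F x l /\ d = Rpower (1 + x) mu * l.

(* gamma_n^(a,b); for n = 0 the factor (a+b+1) Gamma(a+b+1) is written
   as Gamma(a+b+2) (equal when a+b+1 <> 0, and the continuous extension
   when a+b+1 = 0). *)
Definition jgamma (a b : R) (n : nat) : R :=
  match n with
  | O => Rpower 2 (a + b + 1) * Gamma (a + 1) * Gamma (b + 1) / Gamma (a + b + 2)
  | S _ => Rpower 2 (a + b + 1) * Gamma (INR n + a + 1) * Gamma (INR n + b + 1)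
           / ((2 * INR n + a + b + 1) * INR (fact n) * Gamma (INR n + a + b + 1))
  end.

Definition jgamma_tilde (a b : R) (N n : nat) : R :=
  if Nat.eqb n N then (2 + (a + b + 1) / INR N) * jgamma a b N else jgamma a b n.

Definition JGL (a b : R) (N : nat) (xs ws : nat -> R) : Prop :=
  (forall j, (j < N)%nat -> xs j < xs (S j)) /\
  (forall y, (exists d, derivable_pt_lim (Jacobi a b N) y d /\ (1 - y ^ 2) * d = 0)
             <-> exists j, (j <= N)%nat /\ y = xs j) /\
  (forall phi, InPN (2 * N - 1) phi ->
     ImproperInt (fun y => phi y * Rpower (1 - y) a * Rpower (1 + y) b) (-1) 1
                 (sum_f_R0 (fun j => phi (xs j) * ws j) N)).

(* Connection coefficients C l n : P_n^(a,b) = sum_{l<=n} C l n P_l^(c,d),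
   for n <= N (they are unique). *)
Definition IsConn (a b c d : R) (N : nat) (C : nat -> nat -> R) : Prop :=
  forall n, (n <= N)%nat -> forall x,
    Jacobi a b n x = sum_f_R0 (fun l => C l n * Jacobi c d l x) n.

Definition t_coef (a b : R) (N : nat) (xs ws : nat -> R) (n j : nat) : R :=
  ws j / jgamma_tilde a b N n * Jacobi a b n (xs j).

Definition that_coef (a b : R) (N : nat) (xs ws : nat -> R) (C : nat -> nat -> R)
  (l j : nat) : R :=
  sum_f_R0 (fun k => C l (l + k)%nat * t_coef a b N xs ws (l + k)%nat j) (N - l).

Definition zeta (mu : R) (j : nat) : R :=
  match j with O => 1 / Gamma (1 - mu) | S _ => 1 end.

Definition Qhat (a b mu : R) (N : nat) (xs ws : nat -> R) (C : nat -> nat -> R)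
  (j : nat) (x : R) : R :=
  zeta mu j * sum_f_R0 (fun l => Gamma (INR l - mu + 1) / INR (fact l)
                                 * that_coef a b N xs ws C l j * Legendre l x) N.

Definition QhatCond (mu : R) (N : nat) (xs : nat -> R) (j : nat) (Q : R -> R) : Prop :=
  (forall i, (1 <= i <= N)%nat ->
     RLhatD mu Q (xs i) (if Nat.eqb i j then 1 else 0)) /\
  Q (-1) = (if Nat.eqb j 0 then 1 else 0).

(* Main.v *)
Require Import Defs.
From Stdlib Require Import Reals Lra Lia Arith ClassicalEpsilon.
From Coquelicot Require Import Coquelicot.
Open Scope R_scope.

(** On powers of [1 + x] the operator [(1 + x)^mu D^mu] is diagonal, so it is a bijection of
    the polynomials of degree at most [N], whose value at [-1] is [u (-1) / Gamma (1 - mu)].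
    Expanding about [-1] (by the reflection formula) shows that it maps [P_l] to
    [l! / Gamma (l - mu + 1)] times the Jacobi polynomial with parameters [mu, -mu]; hence it
    maps [Qhat_j] to [zeta_j] times [sum_n t_nj P_n^(a,b)].  The latter sum is the [j]-th
    Lagrange polynomial of the nodes, by the discrete orthogonality of the [P_n^(a,b)].
    That in turn follows from the exactness of the quadrature, the Sturm-Liouville equation
    and the Beta integral; all integrals converge because that of the weight does, which is
    the exactness hypothesis for the constant 1. *)

(** [Gamma] is available only as the limit of Gauss' product, so the Beta formula cannot start from
    Euler's integral. It is read off two limits of one sequence instead: raising an exponent of the
    weight by one multiplies its integral by a rational factor, and iterating this yields Pochhammer
    quotients for real exponents and closed forms for integer ones. The end point -1 is a node, yet
    the fractional derivative is in general singular there. The condition at that node is therefore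
    a value of the polynomial itself; division by [Gamma (1 - mu)] turns it into a value of the
    image polynomial, which is the origin of [zeta mu 0]. With it the image is prescribed at all N +
    1 nodes, and interpolation gives existence and uniqueness together. *)

(** * Pochhammer symbols *)

Lemma poch_pos (x : R) (n : nat) : 0 < x -> 0 < poch x n.
Proof.
  intros Hx; induction n as [|n IH]; simpl; [lra|].
  apply Rmult_lt_0_compat; [exact IH|]. pose proof (pos_INR n); lra.
Qed.

Lemma poch_S_left (x : R) (n : nat) : poch x (S n) = x * poch (x + 1) n.
Proof.
  induction n as [|n IH]; [simpl; ring|].
  change (poch x (S n) * (x + INR (S n)) = x * (poch (x + 1) n * (x + 1 + INR n))).
  rewrite IH, S_INR; ring.
Qed.

Lemma poch_1 (n : nat) : poch 1 n = INR (fact n).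
Proof.
  induction n as [|n IH]; [simpl; ring|].
  simpl poch. rewrite IH, fact_simpl, mult_INR, S_INR; ring.
Qed.

Lemma poch_opp_INR_0 (n k : nat) : (n < k)%nat -> poch (- INR n) k = 0.
Proof.
  intros Hk; induction k as [|k IH]; [lia|].
  simpl. destruct (Nat.eq_dec n k) as [->|]; [ring|]. rewrite IH by lia; ring.
Qed.

(** For k <= n every factor -n + i is nonpositive and pairs with one factor [y]; for k > n the
    product vanishes. This gives the terms of a Jacobi expansion a common sign outside the
    interval. *)
Lemma poch_opp_INR_sign (n k : nat) (y : R) : y <= 0 -> 0 <= poch (- INR n) k * y ^ k.
Proof.
  intros Hy; destruct (le_lt_dec k n) as [Hk|Hk];
    [|rewrite poch_opp_INR_0 by exact Hk; lra].
  induction k as [|k IH]; simpl; [lra|].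
  replace (poch (- INR n) k * (- INR n + INR k) * (y * y ^ k))
    with ((poch (- INR n) k * y ^ k) * ((- INR n + INR k) * y)) by ring.
  apply Rmult_le_pos; [apply IH; lia|].
  pose proof (le_INR k n ltac:(lia)). nra.
Qed.

(** * The Gamma function *)

Lemma Bernoulli_Rpower (u x : R) :
  -1 < u -> 0 <= x <= 1 -> Rpower (1 + u) x <= 1 + x * u.
Proof.
  intros Hu Hx. unfold Rpower. set (L := ln (1 + u)).
  assert (HL : exp L = 1 + u) by (apply exp_ln; lra).
  (* convexity of exp: combine the tangent lines at [x * L] *)
  pose proof (exp_ineq1_le (L - x * L)) as H1.
  pose proof (exp_ineq1_le (- (x * L))) as H2.
  pose proof (exp_pos (x * L)) as Hp.
  assert (E1 : exp (L - x * L) * exp (x * L) = 1 + u)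
    by (rewrite <- exp_plus, <- HL; f_equal; ring).
  assert (E2 : exp (- (x * L)) * exp (x * L) = 1)
    by (rewrite <- exp_plus, <- exp_0; f_equal; ring).
  set (e := exp (x * L)) in *.
  assert (A1 : (1 + (L - x * L)) * e <= 1 + u)
    by (rewrite <- E1; apply Rmult_le_compat_r; lra).
  assert (A2 : (1 + - (x * L)) * e <= 1)
    by (rewrite <- E2; apply Rmult_le_compat_r; lra).
  assert (B1 := Rmult_le_compat_l x _ _ (proj1 Hx) A1).
  assert (B2 := Rmult_le_compat_l (1 - x) _ _ ltac:(lra) A2).
  lra.
Qed.

Lemma gauss_seq_pos (x : R) (n : nat) : 0 < x -> 0 < gauss_seq x n.
Proof.
  intros Hx. apply Rdiv_lt_0_compat; [|apply poch_pos; exact Hx].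
  apply Rmult_lt_0_compat; [apply INR_fact_lt_0|apply exp_pos].
Qed.

(** With s = n + 2 the claim reduces to (1 - 1/s)^x <= s / (s + x), which follows from Bernoulli's 1
    - x/s because (s - x)(s + x) <= s^2. Indices start at 1 since [Rpower (INR 0) x] is a default
    value. *)
Lemma gauss_seq_incr (x : R) (n : nat) :
  0 < x <= 1 -> gauss_seq x (S n) <= gauss_seq x (S (S n)).
Proof.
  intros Hx. unfold gauss_seq.
  set (m := S n). assert (Hm : 0 < INR m) by (apply lt_0_INR; lia).
  assert (HB := Bernoulli_Rpower (- / INR (S m)) x).
  assert (Hi : 0 < / INR (S m) < 1).
  { rewrite S_INR. split; [apply Rinv_0_lt_compat; lra|].
    rewrite <- Rinv_1. apply Rinv_lt_contravar; lra. }
  specialize (HB ltac:(lra) ltac:(lra)).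
  assert (E : Rpower (INR m) x = Rpower (1 + - / INR (S m)) x * Rpower (INR (S m)) x).
  { rewrite Rpower_mult_distr; [|lra|apply lt_0_INR; lia].
    f_equal. rewrite S_INR; field; lra. }
  rewrite E, fact_simpl, mult_INR.
  change (poch x (S (S m))) with (poch x (S m) * (x + INR (S m))).
  assert (Hp : 0 < poch x (S m)) by (apply poch_pos; lra).
  set (p := poch x (S m)) in *.
  assert (HS : 0 < INR (S m)) by (apply lt_0_INR; lia).
  set (s := INR (S m)) in *.
  pose proof (INR_fact_lt_0 m) as Hf. set (f := INR (fact m)) in *.
  pose proof (exp_pos (x * ln s)) as HR. fold (Rpower s x) in HR.
  set (r := Rpower s x) in *. set (c := Rpower (1 + - / s) x) in *.
  replace (s * f * r / (p * (x + s))) with ((f * r / p) * (s / (x + s))) by (field; lra).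
  replace (f * (c * r) / p) with ((f * r / p) * c) by (field; lra).
  apply Rmult_le_compat_l; [apply Rlt_le, Rdiv_lt_0_compat; nra|].
  apply Rle_trans with (1 := HB).
  apply Rmult_le_reg_r with (s * (x + s)); [nra|].
  replace (s / (x + s) * (s * (x + s))) with (s * s) by (field; lra).
  replace ((1 + x * - / s) * (s * (x + s))) with ((s - x) * (x + s)) by (field; lra).
  nra.
Qed.

(** Each factor x + m = m (1 + x/m) is at least m (1 + 1/m)^x by Bernoulli, and the product of the
    (1 + 1/m)^x telescopes. This bounds Gauss' sequence by 1/x. *)
Lemma poch_ge_Rpower (x : R) (n : nat) :
  0 < x <= 1 -> x * INR (fact n) * Rpower (INR (S n)) x <= poch x (S n).
Proof.
  intros Hx; induction n as [|n IH].
  - simpl. unfold Rpower. rewrite ln_1, Rmult_0_r, exp_0. lra.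
  - set (m := S n) in *. change (poch x (S m)) with (poch x m * (x + INR m)) in *.
    change (poch x (S m)) with (poch x m * (x + INR m)) in *.
    change (poch x (S n)) with (poch x m) in IH.
    assert (Hm : 0 < INR m) by (apply lt_0_INR; lia).
    assert (Hi : 0 < / INR m) by (apply Rinv_0_lt_compat; lra).
    assert (HB := Bernoulli_Rpower (/ INR m) x ltac:(lra) ltac:(lra)).
    assert (E : Rpower (INR (S m)) x = Rpower (1 + / INR m) x * Rpower (INR m) x).
    { rewrite Rpower_mult_distr; [|lra|lra].
      f_equal. rewrite S_INR; field; lra. }
    rewrite E. unfold m at 1. rewrite fact_simpl, mult_INR. fold m.
    pose proof (poch_pos x m ltac:(lra)).
    pose proof (INR_fact_lt_0 n).
    apply Rle_trans with
      (INR m * (1 + x * / INR m) * (x * INR (fact n) * Rpower (INR m) x)).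
    + pose proof (exp_pos (x * ln (INR m))) as HR. fold (Rpower (INR m) x) in HR.
      set (r := Rpower (INR m) x) in *. set (f := INR (fact n)) in *.
      replace (x * (INR m * f) * (Rpower (1 + / INR m) x * r))
        with ((x * INR m * f * r) * Rpower (1 + / INR m) x) by ring.
      replace (INR m * (1 + x * / INR m) * (x * f * r))
        with ((x * INR m * f * r) * (1 + x * / INR m)) by ring.
      apply Rmult_le_compat_l; [|exact HB].
      repeat apply Rmult_le_pos; lra.
    + replace (INR m * (1 + x * / INR m)) with (x + INR m) by (field; lra).
      rewrite Rmult_comm. apply Rmult_le_compat_r; [lra|exact IH].
Qed.

Lemma gauss_seq_le_inv (x : R) (n : nat) : 0 < x <= 1 -> gauss_seq x (S n) <= / x.
Proof.
  intros Hx. unfold gauss_seq.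
  assert (HP := poch_ge_Rpower x (S n) Hx).
  assert (Hp : 0 < poch x (S (S n))) by (apply poch_pos; lra).
  assert (Hr : Rpower (INR (S n)) x <= Rpower (INR (S (S n))) x).
  { apply Rle_Rpower_l; [lra|]. split; [apply lt_0_INR; lia|apply le_INR; lia]. }
  apply Rmult_le_reg_r with (x * poch x (S (S n))); [nra|].
  set (f := INR (fact (S n))) in *.
  assert (Hf : 0 < f) by apply INR_fact_lt_0.
  replace (f * Rpower (INR (S n)) x / poch x (S (S n)) * (x * poch x (S (S n))))
    with (x * f * Rpower (INR (S n)) x) by (field; lra).
  replace (/ x * (x * poch x (S (S n)))) with (poch x (S (S n))) by (field; lra).
  apply Rle_trans with (2 := HP). apply Rmult_le_compat_l; [nra|exact Hr].
Qed.

Lemma gauss_seq_shift (x : R) (n : nat) : 0 < x ->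
  gauss_seq (x + 1) (S n) = gauss_seq x (S n) * (x * INR (S n) / (x + 1 + INR (S n))).
Proof.
  intros Hx. unfold gauss_seq.
  assert (Hn : 0 < INR (S n)) by (apply lt_0_INR; lia).
  rewrite Rpower_plus, Rpower_1 by exact Hn.
  assert (E : poch (x + 1) (S (S n)) = poch x (S (S n)) * (x + 1 + INR (S n)) / x).
  { rewrite (poch_S_left x). change (poch (x + 1) (S (S n)))
      with (poch (x + 1) (S n) * (x + 1 + INR (S n))). field; lra. }
  rewrite E. pose proof (poch_pos x (S (S n)) Hx). field; lra.
Qed.

Lemma is_lim_seq_ratio (c d : R) : is_lim_seq (fun n => (INR n + c) / (INR n + d)) 1.
Proof.
  apply is_lim_seq_ext_loc with (fun n => 1 + (c - d) * / (INR n + d)).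
  - destruct (INR_unbounded (- d)) as [m Hm]. exists m; intros n Hn.
    apply le_INR in Hn. field; lra.
  - replace (Finite 1) with (Finite (1 + (c - d) * 0)) by (f_equal; ring).
    apply is_lim_seq_plus'; [apply is_lim_seq_const|].
    apply is_lim_seq_mult'; [apply is_lim_seq_const|].
    replace (Finite 0) with (Rbar_inv p_infty) by reflexivity.
    apply is_lim_seq_inv; [|discriminate].
    eapply is_lim_seq_plus; [apply is_lim_seq_INR|apply is_lim_seq_const|].
    reflexivity.
Qed.

Lemma gauss_seq_lim_exists_unit (x : R) :
  0 < x <= 1 -> exists l : R, 0 < l /\ is_lim_seq (gauss_seq x) l.
Proof.
  intros Hx.
  destruct (ex_finite_lim_seq_incr (fun n => gauss_seq x (S n)) (/ x)) as [l Hl].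
  - intros n; apply gauss_seq_incr, Hx.
  - intros n; apply gauss_seq_le_inv, Hx.
  - exists l; split; [|apply is_lim_seq_incr_1; exact Hl].
    apply Rlt_le_trans with (gauss_seq x 1); [apply gauss_seq_pos; lra|].
    assert (H := is_lim_seq_incr_compare _ l Hl (fun n => gauss_seq_incr x n Hx)).
    exact (H O).
Qed.

Lemma gauss_seq_lim_shift (x l : R) : 0 < x ->
  is_lim_seq (gauss_seq x) l -> is_lim_seq (gauss_seq (x + 1)) (x * l).
Proof.
  intros Hx Hl. apply is_lim_seq_incr_1.
  apply is_lim_seq_ext with
    (fun n => gauss_seq x (S n) * (x * ((INR n + 1) / (INR n + (x + 2))))).
  - intros n. rewrite gauss_seq_shift by exact Hx. rewrite S_INR.
    pose proof (pos_INR n). field; lra.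
  - replace (x * l) with (l * (x * 1)) by ring.
    apply is_lim_seq_mult'; [apply (is_lim_seq_incr_1 (gauss_seq x)); exact Hl|].
    apply is_lim_seq_mult'; [apply is_lim_seq_const|apply is_lim_seq_ratio].
Qed.

(** Monotone convergence works on (0, 1] only; the functional equation carries the limit, together
    with its positivity, to larger arguments one unit at a time. *)
Lemma gauss_seq_lim_exists (x : R) :
  0 < x -> exists l : R, 0 < l /\ is_lim_seq (gauss_seq x) l.
Proof.
  intros Hx. destruct (INR_unbounded x) as [m Hm].
  revert x Hx Hm; induction m as [|m IH]; intros x Hx Hm; [simpl in Hm; lra|].
  destruct (Rle_dec x 1) as [H1|H1]; [apply gauss_seq_lim_exists_unit; lra|].
  rewrite S_INR in Hm. destruct (IH (x - 1)) as [l [Hl0 Hl]]; [lra|lra|].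
  exists ((x - 1) * l); split; [nra|].
  replace x with (x - 1 + 1) at 1 by ring. apply gauss_seq_lim_shift; [lra|exact Hl].
Qed.

(** [Gamma] is chosen by [epsilon], so it has content only once a limit is known to exist. All
    further facts about it pass through this limit. *)
Lemma is_lim_gauss_seq (x : R) : 0 < x -> is_lim_seq (gauss_seq x) (Gamma x).
Proof.
  intros Hx. apply is_lim_seq_Reals. unfold Gamma. apply epsilon_spec.
  destruct (gauss_seq_lim_exists x Hx) as [l [_ Hl]].
  exists l; apply is_lim_seq_Reals; exact Hl.
Qed.

Lemma is_lim_seq_eq (u : nat -> R) (l m : R) :
  is_lim_seq u l -> is_lim_seq u m -> l = m.
Proof.
  intros Hl Hm. apply is_lim_seq_unique in Hl, Hm.
  rewrite Hl in Hm; injection Hm; auto.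
Qed.

Lemma Gamma_pos (x : R) : 0 < x -> 0 < Gamma x.
Proof.
  intros Hx. destruct (gauss_seq_lim_exists x Hx) as [l [Hl0 Hl]].
  rewrite (is_lim_seq_eq _ _ _ (is_lim_gauss_seq x Hx) Hl); exact Hl0.
Qed.

Lemma Gamma_succ (x : R) : 0 < x -> Gamma (x + 1) = x * Gamma x.
Proof.
  intros Hx. apply is_lim_seq_eq with (gauss_seq (x + 1)).
  - apply is_lim_gauss_seq; lra.
  - apply gauss_seq_lim_shift; [exact Hx|apply is_lim_gauss_seq, Hx].
Qed.

Lemma Gamma_add_INR (x : R) (n : nat) : 0 < x -> Gamma (x + INR n) = poch x n * Gamma x.
Proof.
  intros Hx; induction n as [|n IH]; [simpl; rewrite Rplus_0_r; ring|].
  rewrite S_INR, <- Rplus_assoc, Gamma_succ, IH; [simpl; ring|].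
  pose proof (pos_INR n); lra.
Qed.

(** * Improper integrals *)

(** Trades the proof-carrying [RiemannInt] of the definition for the relational [is_RInt], in which
    integrals can be combined; the converse is [ImproperInt_elim]. *)
Lemma ImproperInt_intro (f : R -> R) (A B L : R) :
  (forall eps, 0 < eps -> exists delta, 0 < delta /\
    forall c d, A < c -> c < A + delta -> B - delta < d -> d < B -> c < d ->
      exists I, is_RInt f c d I /\ Rabs (I - L) < eps) ->
  ImproperInt f A B L.
Proof.
  intros H eps He. destruct (H eps He) as [delta [Hd HI]].
  exists delta; split; [exact Hd|]. intros c d H1 H2 H3 H4 H5.
  destruct (HI c d H1 H2 H3 H4 H5) as [I [HI1 HI2]].
  assert (ex : ex_RInt f c d) by (exists I; exact HI1).
  exists (ex_RInt_Reals_0 _ _ _ ex). rewrite <- RInt_Reals.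
  rewrite (is_RInt_unique _ _ _ _ HI1). exact HI2.
Qed.

Lemma ImproperInt_elim (f : R -> R) (A B L : R) :
  ImproperInt f A B L ->
  forall eps, 0 < eps -> exists delta, 0 < delta /\
    forall c d, A < c -> c < A + delta -> B - delta < d -> d < B -> c < d ->
      exists I, is_RInt f c d I /\ Rabs (I - L) < eps.
Proof.
  intros H eps He. destruct (H eps He) as [delta [Hd HI]].
  exists delta; split; [exact Hd|]. intros c d H1 H2 H3 H4 H5.
  destruct (HI c d H1 H2 H3 H4 H5) as [pr Hpr].
  exists (RiemannInt pr); split; [|exact Hpr].
  rewrite <- RInt_Reals. apply (RInt_correct f), ex_RInt_Reals_1, pr.
Qed.

Lemma ImproperInt_ext (f g : R -> R) (A B L : R) :
  (forall y, A < y < B -> f y = g y) -> ImproperInt f A B L -> ImproperInt g A B L.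
Proof.
  intros E H. apply ImproperInt_intro. intros eps He.
  destruct (ImproperInt_elim _ _ _ _ H eps He) as [delta [Hd HI]].
  exists delta; split; [exact Hd|]. intros c d H1 H2 H3 H4 H5.
  destruct (HI c d H1 H2 H3 H4 H5) as [I [HI1 HI2]].
  exists I; split; [|exact HI2]. apply is_RInt_ext with (2 := HI1).
  rewrite Rmin_left, Rmax_right by lra. intros y Hy; apply E; lra.
Qed.

Lemma ImproperInt_lin (f g : R -> R) (A B L M s t : R) :
  ImproperInt f A B L -> ImproperInt g A B M ->
  ImproperInt (fun y => s * f y + t * g y) A B (s * L + t * M).
Proof.
  intros Hf Hg. apply ImproperInt_intro. intros eps He.
  (* The summand 1 keeps [K] positive when both scalars vanish and makes the final bound strict. *)
  set (K := 1 + Rabs s + Rabs t).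
  assert (HK : 0 < K) by (unfold K; pose proof (Rabs_pos s); pose proof (Rabs_pos t); lra).
  assert (He' : 0 < eps / K) by (apply Rdiv_lt_0_compat; lra).
  destruct (ImproperInt_elim _ _ _ _ Hf _ He') as [d1 [Hd1 HI1]].
  destruct (ImproperInt_elim _ _ _ _ Hg _ He') as [d2 [Hd2 HI2]].
  exists (Rmin d1 d2); split; [apply Rmin_pos; assumption|].
  pose proof (Rmin_l d1 d2); pose proof (Rmin_r d1 d2).
  intros c d H1 H2 H3 H4 H5.
  destruct (HI1 c d) as [I [I1 I2]]; try lra.
  destruct (HI2 c d) as [J [J1 J2]]; try lra.
  exists (s * I + t * J); split.
  - apply (is_RInt_plus (V := R_NormedModule)); apply (is_RInt_scal (V := R_NormedModule)); assumption.
  - replace (s * I + t * J - (s * L + t * M)) with (s * (I - L) + t * (J - M)) by ring.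
    apply Rle_lt_trans with (1 := Rabs_triang _ _). rewrite !Rabs_mult.
    apply Rle_lt_trans with (Rabs s * (eps / K) + Rabs t * (eps / K)).
    + apply Rplus_le_compat; apply Rmult_le_compat_l; try apply Rabs_pos; lra.
    + replace eps with (eps / K * K) at 3 by (field; lra). unfold K at 4. nra.
Qed.

Lemma ImproperInt_scal (f : R -> R) (A B L s : R) :
  ImproperInt f A B L -> ImproperInt (fun y => s * f y) A B (s * L).
Proof.
  intros H. eapply ImproperInt_ext; [|eapply eq_rect;
    [apply (ImproperInt_lin _ _ _ _ _ _ s 0 H H)|ring]].
  intros y _; simpl; ring.
Qed.

Lemma ImproperInt_le (f g : R -> R) (A B L M : R) : A < B ->
  ImproperInt f A B L -> ImproperInt g A B M ->
  (forall y, A < y < B -> f y <= g y) -> L <= M.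
Proof.
  intros HAB Hf Hg Hle. apply Rnot_lt_le; intros Hlt.
  set (eps := (L - M) / 2). assert (He : 0 < eps) by (unfold eps; lra).
  destruct (ImproperInt_elim _ _ _ _ Hf _ He) as [d1 [Hd1 HI1]].
  destruct (ImproperInt_elim _ _ _ _ Hg _ He) as [d2 [Hd2 HI2]].
  set (h := Rmin (Rmin d1 d2) (B - A) / 3).
  pose proof (Rmin_l d1 d2); pose proof (Rmin_r d1 d2).
  pose proof (Rmin_l (Rmin d1 d2) (B - A)); pose proof (Rmin_r (Rmin d1 d2) (B - A)).
  assert (0 < Rmin (Rmin d1 d2) (B - A)) by (repeat apply Rmin_pos; lra).
  destruct (HI1 (A + h) (B - h)) as [I [I1 I2]]; try (unfold h; lra).
  destruct (HI2 (A + h) (B - h)) as [J [J1 J2]]; try (unfold h; lra).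
  assert (I <= J).
  { apply is_RInt_le with (2 := I1) (3 := J1); [unfold h; lra|].
    intros y Hy; apply Hle; unfold h in Hy; lra. }
  apply Rabs_def2 in I2, J2. unfold eps in *; lra.
Qed.

Lemma ImproperInt_unique (f : R -> R) (A B L M : R) : A < B ->
  ImproperInt f A B L -> ImproperInt f A B M -> L = M.
Proof.
  intros HAB H1 H2. apply Rle_antisym.
  - apply (ImproperInt_le f f A B); auto; intros; lra.
  - apply (ImproperInt_le f f A B); auto; intros; lra.
Qed.

Lemma ImproperInt_derive (F f : R -> R) (A B lA lB : R) :
  (forall y, A < y < B -> is_derive F y (f y)) ->
  (forall y, A < y < B -> continuous f y) ->
  filterlim F (at_right A) (locally lA) -> filterlim F (at_left B) (locally lB) ->
  ImproperInt f A B (lB - lA).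
Proof.
  intros HF Hf HA HB. apply ImproperInt_intro. intros eps He.
  assert (He2 : 0 < eps / 2) by lra.
  destruct (proj1 (filterlim_locally F lA) HA (mkposreal _ He2)) as [dA HdA].
  destruct (proj1 (filterlim_locally F lB) HB (mkposreal _ He2)) as [dB HdB].
  exists (Rmin dA dB); split; [apply Rmin_pos; apply cond_pos|].
  pose proof (Rmin_l dA dB); pose proof (Rmin_r dA dB).
  intros c d H1 H2 H3 H4 H5. exists (F d - F c); split.
  - apply (is_RInt_derive (V := R_CompleteNormedModule) F f);
      rewrite Rmin_left, Rmax_right by lra; intros y Hy; [apply HF|apply Hf]; lra.
  - assert (Hc : ball lA (mkposreal _ He2) (F c)).
    { apply HdA; [|exact H1]. apply Rabs_def1; simpl; unfold minus, plus, opp; simpl; lra. }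
    assert (Hd : ball lB (mkposreal _ He2) (F d)).
    { apply HdB; [|exact H4]. apply Rabs_def1; simpl; unfold minus, plus, opp; simpl; lra. }
    apply Rabs_def2 in Hc, Hd. unfold minus, plus, opp in *; simpl in *.
    apply Rabs_def1; lra.
Qed.

(** * Jacobi weights *)

(** The end points stay general because two intervals occur: (-1, 1) with the Jacobi weight, and
    (-1, x) with the kernel of the fractional integral times a power of 1 + y. *)
Definition weight (A B p q y : R) : R := Rpower (B - y) p * Rpower (y - A) q.

Lemma weight_succ_l (A B p q y : R) :
  y < B -> weight A B (p + 1) q y = (B - y) * weight A B p q y.
Proof. intros Hy. unfold weight. rewrite Rpower_plus, Rpower_1 by lra. ring. Qed.

Lemma weight_succ_r (A B p q y : R) :
  A < y -> weight A B p (q + 1) y = (y - A) * weight A B p q y.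
Proof. intros Hy. unfold weight. rewrite Rpower_plus, Rpower_1 by lra. ring. Qed.

Lemma is_derive_Rpower (u r : R) :
  0 < u -> is_derive (fun x => Rpower x r) u (r * Rpower u (r - 1)).
Proof. intros Hu. apply is_derive_Reals, derivable_pt_lim_power, Hu. Qed.

Lemma is_derive_Rpower_affine (s h r y : R) : 0 < s * y + h ->
  is_derive (fun x => Rpower (s * x + h) r) y (s * (r * Rpower (s * y + h) (r - 1))).
Proof.
  intros Hy. apply (is_derive_comp (fun x => Rpower x r) (fun x => s * x + h)).
  - apply is_derive_Rpower, Hy.
  - auto_derive; [exact I|ring].
Qed.

Lemma is_derive_weight (A B p q y : R) : A < y < B ->
  is_derive (weight A B (p + 1) (q + 1)) y
    (((q + 1) * (B - y) - (p + 1) * (y - A)) * weight A B p q y).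
Proof.
  intros Hy.
  assert (H1 := is_derive_Rpower_affine (-1) B (p + 1) y ltac:(lra)).
  assert (H2 := is_derive_Rpower_affine 1 (- A) (q + 1) y ltac:(lra)).
  assert (H := is_derive_mult _ _ y _ _ H1 H2 Rmult_comm).
  eapply is_derive_ext; [|eapply (eq_rect _ _ H)].
  - intros t. unfold mult; simpl. unfold weight. f_equal; f_equal; ring.
  - unfold plus, mult; simpl. unfold weight.
    replace (-1 * y + B) with (B - y) by ring. replace (1 * y + - A) with (y - A) by ring.
    replace (p + 1 - 1) with p by ring. replace (q + 1 - 1) with q by ring.
    rewrite !Rpower_plus, !Rpower_1 by lra. ring.
Qed.

Lemma continuous_weight (A B p q y : R) : A < y < B -> continuous (weight A B p q) y.
Proof.
  intros Hy. apply (ex_derive_continuous (weight A B p q)).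
  replace p with (p - 1 + 1) by ring. replace q with (q - 1 + 1) by ring.
  eexists; apply is_derive_weight, Hy.
Qed.

Lemma filterlim_Rpower_0 (r : R) :
  0 < r -> filterlim (fun u => Rpower u r) (at_right 0) (locally 0).
Proof.
  intros Hr. apply filterlim_locally. intros eps.
  exists (mkposreal (Rpower eps (/ r)) (exp_pos _)). intros u Hu Hu0.
  apply Rabs_def2 in Hu. unfold minus, plus, opp in Hu; simpl in Hu.
  apply Rabs_def1; unfold minus, plus, opp; simpl.
  - apply Rlt_le_trans with (Rpower (Rpower eps (/ r)) r + - 0).
    + apply Rplus_lt_compat_r. apply Rlt_Rpower_l; lra.
    + rewrite Rpower_mult. replace (/ r * r) with 1 by (field; lra).
      rewrite Rpower_1 by apply cond_pos. lra.
  - pose proof (exp_pos (r * ln u)). fold (Rpower u r) in H.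
    pose proof (cond_pos eps). lra.
Qed.

Lemma filterlim_mult_0 (f g : R -> R) (F : (R -> Prop) -> Prop) {FF : Filter F} (l : R) :
  filterlim f F (locally 0) -> filterlim g F (locally l) ->
  filterlim (fun y => f y * g y) F (locally 0).
Proof.
  intros Hf Hg. replace 0 with (mult (K := R_AbsRing) 0 l) by (unfold mult; simpl; ring).
  eapply (filterlim_comp_2 (G := locally (0 : R)) (H := locally (l : R))); [exact Hf|exact Hg|].
  apply (filterlim_mult (K := R_AbsRing)).
Qed.

Lemma filterlim_weight_right (A B p q : R) (v : R -> R) : A < B -> -1 < q ->
  continuous v A ->
  filterlim (fun y => weight A B (p + 1) (q + 1) y * v y) (at_right A) (locally 0).
Proof.
  intros HAB Hq Hv.
  apply filterlim_ext with
    (fun y => Rpower (y - A) (q + 1) * (Rpower (B - y) (p + 1) * v y)).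
  { intros y; unfold weight; ring. }
  apply (filterlim_mult_0 _ _ _ (Rpower (B - A) (p + 1) * v A)).
  - apply (filterlim_comp _ _ _ (fun y => y - A) (fun u => Rpower u (q + 1)) _ (at_right 0));
      [|apply filterlim_Rpower_0; lra].
    intros P [e He]. exists e. intros y Hy Hy0. apply He; [|lra].
    apply Rabs_def2 in Hy. unfold minus, plus, opp in Hy; simpl in Hy.
    apply Rabs_def1; unfold minus, plus, opp; simpl; lra.
  - apply (filterlim_filter_le_1 (F := locally A)).
    { apply (filter_le_within (F := locally _)). }
    apply (continuous_mult (fun y => Rpower (B - y) (p + 1)) v A); [|exact Hv].
    apply (ex_derive_continuous (fun y => Rpower (B - y) (p + 1))).
    eexists. eapply is_derive_ext; [|apply (is_derive_Rpower_affine (-1) B); lra].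
    intros t; simpl; f_equal; ring.
Qed.

Lemma filterlim_weight_left (A B p q : R) (v : R -> R) : A < B -> -1 < p ->
  continuous v B ->
  filterlim (fun y => weight A B (p + 1) (q + 1) y * v y) (at_left B) (locally 0).
Proof.
  intros HAB Hp Hv.
  apply filterlim_ext with
    (fun y => Rpower (B - y) (p + 1) * (Rpower (y - A) (q + 1) * v y)).
  { intros y; unfold weight; ring. }
  apply (filterlim_mult_0 _ _ _ (Rpower (B - A) (q + 1) * v B)).
  - apply (filterlim_comp _ _ _ (fun y => B - y) (fun u => Rpower u (p + 1)) _ (at_right 0));
      [|apply filterlim_Rpower_0; lra].
    intros P [e He]. exists e. intros y Hy Hy0. apply He; [|lra].
    apply Rabs_def2 in Hy. unfold minus, plus, opp in Hy; simpl in Hy.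
    apply Rabs_def1; unfold minus, plus, opp; simpl; lra.
  - apply (filterlim_filter_le_1 (F := locally B)).
    { apply (filter_le_within (F := locally _)). }
    apply (continuous_mult (fun y => Rpower (y - A) (q + 1)) v B); [|exact Hv].
    apply (ex_derive_continuous (fun y => Rpower (y - A) (q + 1))).
    eexists. eapply is_derive_ext; [|apply (is_derive_Rpower_affine 1 (- A)); lra].
    intros t; simpl; f_equal; ring.
Qed.

(** The integrand is the derivative of [weight A B (p + 1) (q + 1) y * v y], whose limits at both
    ends vanish because the raised exponents are positive. Convergence of the whole combination
    comes for free from this primitive. The exponent recursion and the Sturm-Liouville identity are
    both instances. *)
Lemma ImproperInt_weight_by_parts (A B p q : R) (v v' : R -> R) :
  A < B -> -1 < p -> -1 < q ->
  (forall y, is_derive v y (v' y)) -> (forall y, continuous v' y) ->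
  ImproperInt (fun y => ((B - y) * (y - A) * v' y
      + ((q + 1) * (B - y) - (p + 1) * (y - A)) * v y) * weight A B p q y) A B 0.
Proof.
  intros HAB Hp Hq Hv Hv'.
  assert (Hvc : forall y, continuous v y).
  { intros y. apply (ex_derive_continuous v). eexists; apply Hv. }
  rewrite <- (Rminus_0_r 0).
  apply ImproperInt_derive with (fun y => weight A B (p + 1) (q + 1) y * v y).
  - intros y Hy.
    assert (H := is_derive_mult _ _ y _ _ (is_derive_weight A B p q y Hy) (Hv y) Rmult_comm).
    eapply eq_rect; [exact H|]. unfold plus, mult; simpl.
    rewrite weight_succ_l, weight_succ_r by lra. ring.
  - intros y Hy. apply (continuous_mult (K := R_AbsRing)); [|apply continuous_weight, Hy].
    apply (continuous_plus (V := R_NormedModule)); apply (continuous_mult (K := R_AbsRing)); auto.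
    + apply (ex_derive_continuous (fun y => (B - y) * (y - A))). auto_derive; exact I.
    + apply (ex_derive_continuous (fun y => (q + 1) * (B - y) - (p + 1) * (y - A))).
      auto_derive; exact I.
  - apply filterlim_weight_right; auto.
  - apply filterlim_weight_left; auto.
Qed.

(** Integration by parts with v = 1, after rewriting (q+1)(B-y) - (p+1)(y-A) as (q+1)(B-A) -
    (p+q+2)(y-A). *)
Lemma ImproperInt_weight_succ_r (A B p q L : R) : A < B -> -1 < p -> -1 < q ->
  ImproperInt (weight A B p q) A B L ->
  ImproperInt (weight A B p (q + 1)) A B ((q + 1) / (p + q + 2) * (B - A) * L).
Proof.
  intros HAB Hp Hq HL.
  assert (H0 := ImproperInt_weight_by_parts A B p q (fun _ => 1) (fun _ => 0) HAB Hp Hq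
    ltac:(intros; auto_derive; [exact I|ring]) ltac:(intros; apply continuous_const)).
  assert (H := ImproperInt_lin _ _ _ _ _ _ ((q + 1) / (p + q + 2) * (B - A)) (- / (p + q + 2)) HL H0).
  replace ((q + 1) / (p + q + 2) * (B - A) * L)
    with ((q + 1) / (p + q + 2) * (B - A) * L + - / (p + q + 2) * 0) by ring.
  eapply ImproperInt_ext; [|exact H]. intros y Hy. simpl.
  rewrite weight_succ_r by lra. field; lra.
Qed.

Lemma ImproperInt_weight_0_r (A B p : R) : A < B -> -1 < p ->
  ImproperInt (weight A B p 0) A B (Rpower (B - A) (p + 1) / (p + 1)).
Proof.
  intros HAB Hp.
  replace (Rpower (B - A) (p + 1) / (p + 1))
    with (0 - - (Rpower (B - A) (p + 1) / (p + 1))) by ring.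
  apply ImproperInt_derive with (fun y => - (Rpower (B - y) (p + 1) / (p + 1))).
  - intros y Hy.
    assert (H := is_derive_scal _ y (- / (p + 1)) _ (is_derive_Rpower_affine (-1) B (p + 1) y ltac:(lra))).
    eapply is_derive_ext; [|eapply (eq_rect _ _ H)].
    + intros t; simpl. replace (-1 * t + B) with (B - t) by ring. field; lra.
    + simpl. unfold weight. replace (-1 * y + B) with (B - y) by ring.
      rewrite Rpower_O by lra. replace (p + 1 - 1) with p by ring. field; lra.
  - intros y Hy. apply continuous_weight, Hy.
  - apply (filterlim_filter_le_1 (F := locally A)); [apply (filter_le_within (F := locally _))|].
    apply (ex_derive_continuous (fun y => - (Rpower (B - y) (p + 1) / (p + 1))) A).
    eexists.
    eapply is_derive_ext; [|apply is_derive_scal with (k := - / (p + 1)),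
       (is_derive_Rpower_affine (-1) B (p + 1)); lra].
    intros t; simpl. replace (-1 * t + B) with (B - t) by ring. field; lra.
  (* At [B] the primitive is discontinuous, since [Rpower 0 (p + 1)] takes the default value 1;
     hence the one-sided limit is computed by hand. *)
  - apply filterlim_ext with (fun y => Rpower (B - y) (p + 1) * - / (p + 1)).
    { intros y; field; lra. }
    apply (filterlim_mult_0 _ _ _ (- / (p + 1))); [|apply filterlim_const].
    apply (filterlim_comp _ _ _ (fun y => B - y) (fun u => Rpower u (p + 1)) _ (at_right 0));
      [|apply filterlim_Rpower_0; lra].
    intros P [e He]. exists e. intros y Hy Hy0. apply He; [|lra].
    apply Rabs_def2 in Hy. unfold minus, plus, opp in Hy; simpl in Hy.
    apply Rabs_def1; unfold minus, plus, opp; simpl; lra.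
Qed.

(** At an integer exponent the recursion descends to an explicit primitive. The closed form serves
    twice: as the bounds that squeeze the Beta integral, and as the fractional integral of a power
    of 1 + y. *)
Lemma ImproperInt_weight_INR_r (A B p : R) (k : nat) : A < B -> -1 < p ->
  ImproperInt (weight A B p (INR k)) A B
    (Rpower (B - A) (p + 1 + INR k) * INR (fact k) / poch (p + 1) (S k)).
Proof.
  intros HAB Hp; induction k as [|k IH].
  - eapply eq_rect; [apply ImproperInt_weight_0_r; assumption|].
    simpl. rewrite !Rplus_0_r. field; lra.
  - rewrite S_INR.
    pose proof (pos_INR k).
    eapply eq_rect; [apply (ImproperInt_weight_succ_r A B p (INR k)); [assumption..|lra|exact IH]|].
    replace (p + 1 + (INR k + 1)) with (p + 1 + INR k + 1) by ring.
    rewrite (Rpower_plus (p + 1 + INR k) 1), Rpower_1 by lra.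
    rewrite fact_simpl, mult_INR.
    change (poch (p + 1) (S (S k))) with (poch (p + 1) (S k) * (p + 1 + INR (S k))).
    rewrite S_INR. pose proof (poch_pos (p + 1) (S k) ltac:(lra)).
    field; lra.
Qed.

(** * The Beta integral *)

(** The normalized weight is a power of (y - A)/(B - A), which lies below 1, so it decreases in the
    exponent. Real exponents can thus be compared with the neighbouring integers. *)
Lemma weight_normalized_decr (A B p r s y : R) : A < y < B -> r <= s ->
  Rpower (B - A) (- s) * weight A B p s y <= Rpower (B - A) (- r) * weight A B p r y.
Proof.
  intros Hy Hrs. unfold weight.
  assert (Hln : ln (y - A) < ln (B - A)) by (apply ln_increasing; lra).
  assert (H : Rpower (B - A) (- s) * Rpower (y - A) s
              <= Rpower (B - A) (- r) * Rpower (y - A) r).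
  { unfold Rpower. rewrite <- !exp_plus. 
    assert (E : - s * ln (B - A) + s * ln (y - A) <= - r * ln (B - A) + r * ln (y - A)) by nra.
    destruct E as [E|E]; [left; apply exp_increasing, E|rewrite E; lra]. }
  pose proof (exp_pos (p * ln (B - y))) as Hp. fold (Rpower (B - y) p) in Hp.
  nra.
Qed.

Lemma ImproperInt_weight_add_INR (A B p q L : R) (n : nat) : A < B -> -1 < p -> -1 < q ->
  ImproperInt (weight A B p q) A B L ->
  ImproperInt (weight A B p (q + INR n)) A B
    (Rpower (B - A) (INR n) * (poch (q + 1) n / poch (p + q + 2) n) * L).
Proof.
  intros HAB Hp Hq HL; induction n as [|n IH].
  - simpl. rewrite Rplus_0_r, Rpower_O by lra. eapply eq_rect; [exact HL|field].
  - pose proof (pos_INR n). rewrite S_INR, <- Rplus_assoc.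
    eapply eq_rect; [apply ImproperInt_weight_succ_r; [assumption..|lra|exact IH]|].
    rewrite Rpower_plus, Rpower_1 by lra.
    change (poch (q + 1) (S n)) with (poch (q + 1) n * (q + 1 + INR n)).
    change (poch (p + q + 2) (S n)) with (poch (p + q + 2) n * (p + q + 2 + INR n)).
    pose proof (poch_pos (p + q + 2) n ltac:(lra)). field. split; lra.
Qed.

(** Gauss' product at index n + m, but with the power of n instead of n + m; the correction
    (n/(n+m))^x tends to 1. *)
Lemma is_lim_seq_gauss_shift (x : R) (m : nat) : 0 < x ->
  is_lim_seq (fun n => Rpower (INR n) x * (INR (fact (n + m)) / poch x (S (n + m)))) (Gamma x).
Proof.
  intros Hx.
  apply is_lim_seq_ext_loc with
    (fun n => gauss_seq x (n + m) * Rpower ((INR n + 0) / (INR n + INR m)) x).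
  - exists 1%nat. intros n Hn. unfold gauss_seq.
    assert (H1 : 0 < INR n) by (apply lt_0_INR; lia).
    pose proof (pos_INR m). pose proof (poch_pos x (S (n + m)) Hx).
    assert (E : Rpower (INR n) x
                = Rpower ((INR n + 0) / (INR n + INR m)) x * Rpower (INR (n + m)) x).
    { rewrite Rpower_mult_distr, plus_INR.
      - f_equal; field; lra.
      - apply Rdiv_lt_0_compat; lra.
      - rewrite plus_INR; lra. }
    rewrite E. field; lra.
  - replace (Gamma x) with (Gamma x * Rpower 1 x)
      by (unfold Rpower; rewrite ln_1, Rmult_0_r, exp_0; ring).
    apply is_lim_seq_mult'.
    + apply (is_lim_seq_incr_n (gauss_seq x)), is_lim_gauss_seq, Hx.
    + apply (is_lim_seq_continuous (fun u => Rpower u x)).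
      * apply derivable_continuous_pt. eexists; apply derivable_pt_lim_power; lra.
      * apply is_lim_seq_ratio.
Qed.

Lemma exists_INR_between (x : R) : -1 < x -> exists m : nat, INR m - 1 <= x <= INR m.
Proof.
  intros Hx. destruct (INR_unbounded x) as [m Hm].
  induction m as [|m IH].
  - exists O. simpl in *; lra.
  - destruct (Rlt_dec x (INR m)) as [H|H]; [apply IH, H|].
    exists (S m). rewrite S_INR in *; lra.
Qed.

(* [weight A B a (b + n)] is squeezed between integer exponents, where the integral
   is the [n]-th term of Gauss' product. *)
Lemma ImproperInt_weight_Beta (A B a b L : R) : A < B -> -1 < a -> -1 < b ->
  ImproperInt (weight A B a b) A B L ->
  L = Rpower (B - A) (a + b + 1) * Gamma (a + 1) * Gamma (b + 1) / Gamma (a + b + 2).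
Proof.
  intros HAB Ha Hb HL.
  destruct (exists_INR_between b Hb) as [m Hm].
  set (D := B - A). assert (HD : 0 < D) by (unfold D; lra).
  (* Up to powers of [D], this is n^(a+1) times the integral with exponent b + n + 1, and the choice
     of [m] places that exponent between n + m and n + m + 1. *)
  set (u := fun n => Rpower (INR n) (a + 1)
     * (Rpower D (- (a + b + 1)) * L * (poch (b + 1) (S n) / poch (a + b + 2) (S n)))).
  assert (Hu1 : is_lim_seq u (Gamma (a + 1))).
  { apply is_lim_seq_le_le with
      (fun n => Rpower (INR n) (a + 1) * (INR (fact (n + S m)) / poch (a + 1) (S (n + S m))))
      (fun n => Rpower (INR n) (a + 1) * (INR (fact (n + m)) / poch (a + 1) (S (n + m))));
      [|apply is_lim_seq_gauss_shift; lra..].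
    intros n. unfold u.
    assert (HJ := ImproperInt_weight_add_INR A B a b L (S n) HAB Ha Hb HL).
    assert (H1 := ImproperInt_weight_INR_r A B a (n + S m) HAB Ha).
    assert (H2 := ImproperInt_weight_INR_r A B a (n + m) HAB Ha).
    fold D in HJ, H1, H2.
    apply (ImproperInt_scal _ _ _ _ (Rpower D (- (b + INR (S n))))) in HJ.
    apply (ImproperInt_scal _ _ _ _ (Rpower D (- INR (n + S m)))) in H1.
    apply (ImproperInt_scal _ _ _ _ (Rpower D (- INR (n + m)))) in H2.
    assert (L1 := ImproperInt_le _ _ A B _ _ HAB H1 HJ).
    assert (L2 := ImproperInt_le _ _ A B _ _ HAB HJ H2).
    assert (Hpow : forall x y, Rpower D (- x) * Rpower D (a + 1 + y) = Rpower D (a + 1 + (y - x)))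
      by (intros x y; rewrite <- Rpower_plus; f_equal; ring).
    assert (E1 : forall k, Rpower D (- INR k)
        * (Rpower D (a + 1 + INR k) * INR (fact k) / poch (a + 1) (S k))
        = Rpower D (a + 1) * (INR (fact k) / poch (a + 1) (S k))).
    { intros k. pose proof (poch_pos (a + 1) (S k) ltac:(lra)).
      transitivity (Rpower D (- INR k) * Rpower D (a + 1 + INR k)
         * (INR (fact k) / poch (a + 1) (S k))); [field; lra|].
      rewrite Hpow. do 2 f_equal; ring. }
    rewrite E1 in L1, L2.
    assert (E2 : Rpower D (- (b + INR (S n))) *
        (Rpower D (INR (S n)) * (poch (b + 1) (S n) / poch (a + b + 2) (S n)) * L)
       = Rpower D (a + 1) * (Rpower D (- (a + b + 1)) * L
          * (poch (b + 1) (S n) / poch (a + b + 2) (S n)))).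
    { transitivity (Rpower D (- (b + INR (S n))) * Rpower D (INR (S n))
         * (L * (poch (b + 1) (S n) / poch (a + b + 2) (S n)))); [ring|].
      transitivity (Rpower D (a + 1) * Rpower D (- (a + b + 1))
         * (L * (poch (b + 1) (S n) / poch (a + b + 2) (S n)))); [|ring].
      rewrite <- !Rpower_plus. do 2 f_equal; ring. }
    rewrite E2 in L1, L2.
    pose proof (exp_pos ((a + 1) * ln D)) as HDp. fold (Rpower D (a + 1)) in HDp.
    pose proof (exp_pos ((a + 1) * ln (INR n))) as Hnp. fold (Rpower (INR n) (a + 1)) in Hnp.
    split; (apply Rmult_le_compat_l; [lra|]; apply Rmult_le_reg_l with (Rpower D (a + 1));
      [exact HDp|]).
    - apply L1. intros y Hy. apply weight_normalized_decr; [exact Hy|].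
      rewrite plus_INR, !S_INR; lra.
    - apply L2. intros y Hy. apply weight_normalized_decr; [exact Hy|].
      rewrite plus_INR, !S_INR; lra. }
  assert (Gb := Gamma_pos (b + 1) ltac:(lra)). assert (Gab := Gamma_pos (a + b + 2) ltac:(lra)).
  (* The same sequence is a constant times the quotient of the Gauss sequences at a + b + 2 and b +
     1, the factorials cancelling. Equating the two limits determines [L]. *)
  assert (Hu2 : is_lim_seq u (Rpower D (- (a + b + 1)) * L
                              * (Gamma (a + b + 2) * / Gamma (b + 1)))).
  { apply is_lim_seq_ext_loc with
      (fun n => Rpower D (- (a + b + 1)) * L * (gauss_seq (a + b + 2) n * / gauss_seq (b + 1) n)).
    - exists 1%nat. intros n Hn. unfold u, gauss_seq.
      assert (E : Rpower (INR n) (a + b + 2) = Rpower (INR n) (a + 1) * Rpower (INR n) (b + 1))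
        by (rewrite <- Rpower_plus; f_equal; ring).
      rewrite E.
      pose proof (poch_pos (b + 1) (S n) ltac:(lra)).
      pose proof (poch_pos (a + b + 2) (S n) ltac:(lra)).
      pose proof (exp_pos ((b + 1) * ln (INR n))) as Hnp. fold (Rpower (INR n) (b + 1)) in Hnp.
      pose proof (INR_fact_lt_0 n). field. repeat split; lra.
    - apply is_lim_seq_mult'; [apply is_lim_seq_const|].
      apply is_lim_seq_mult'; [apply is_lim_gauss_seq; lra|].
      apply (is_lim_seq_inv _ (Finite (Gamma (b + 1)))); [apply is_lim_gauss_seq; lra|].
      intros E; injection E; lra. }
  assert (E := is_lim_seq_eq _ _ _ Hu1 Hu2). fold D. rewrite E, Rpower_Ropp.
  pose proof (exp_pos ((a + b + 1) * ln D)) as HDp. fold (Rpower D (a + b + 1)) in HDp.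
  field. repeat split; lra.
Qed.

(** * Polynomial functions *)

Lemma sum_f_R0_zero (f : nat -> R) (n : nat) :
  (forall k, (k <= n)%nat -> f k = 0) -> sum_f_R0 f n = 0.
Proof.
  intros H; induction n as [|n IH]; simpl; [apply H; lia|].
  rewrite IH, (H (S n)); [ring|lia|intros k Hk; apply H; lia].
Qed.

Lemma sum_f_R0_trunc (f : nat -> R) (n m : nat) : (n <= m)%nat ->
  (forall k, (n < k)%nat -> f k = 0) -> sum_f_R0 f m = sum_f_R0 f n.
Proof.
  intros Hnm H; induction Hnm as [|m Hm IH]; [reflexivity|].
  simpl. rewrite IH, H by lia; ring.
Qed.

Lemma sum_f_R0_single (f : nat -> R) (n m : nat) : (m <= n)%nat ->
  (forall k, (k <= n)%nat -> k <> m -> f k = 0) -> sum_f_R0 f n = f m.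
Proof.
  intros Hm H; induction n as [|n IH].
  - replace m with O by lia. reflexivity.
  - simpl. destruct (Nat.eq_dec m (S n)) as [->|Hne].
    + rewrite sum_f_R0_zero; [ring|]. intros k Hk; apply H; lia.
    + rewrite IH, (H (S n)); try lia; [ring|]. intros k Hk; apply H; lia.
Qed.

Lemma sum_f_R0_exchange (f : nat -> nat -> R) (n m : nat) :
  sum_f_R0 (fun i => sum_f_R0 (f i) m) n
  = sum_f_R0 (fun j => sum_f_R0 (fun i => f i j) n) m.
Proof.
  induction n as [|n IH]; simpl; [reflexivity|].
  rewrite IH, <- plus_sum. apply sum_eq; intros; reflexivity.
Qed.

Lemma sum_f_R0_scal (c : R) (f : nat -> R) (n : nat) :
  c * sum_f_R0 f n = sum_f_R0 (fun k => c * f k) n.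
Proof. rewrite scal_sum. apply sum_eq; intros; ring. Qed.

Lemma is_derive_sum_f_R0 (f : nat -> R -> R) (d : nat -> R) (n : nat) (x : R) :
  (forall k, (k <= n)%nat -> is_derive (f k) x (d k)) ->
  is_derive (fun y => sum_f_R0 (fun k => f k y) n) x (sum_f_R0 d n).
Proof.
  intros H; induction n as [|n IH]; simpl; [apply H; lia|].
  apply (is_derive_plus (V := R_NormedModule)); [apply IH; intros; apply H; lia|apply H; lia].
Qed.

Lemma InPN_ext (n : nat) (f g : R -> R) : (forall x, f x = g x) -> InPN n f -> InPN n g.
Proof. intros E [c Hc]; exists c; intros x; rewrite <- E; apply Hc. Qed.

Lemma InPN_plus (n : nat) (f g : R -> R) :
  InPN n f -> InPN n g -> InPN n (fun x => f x + g x).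
Proof.
  intros [c Hc] [d Hd]; exists (fun k => c k + d k); intros x.
  rewrite Hc, Hd, <- plus_sum. apply sum_eq; intros; ring.
Qed.

Lemma InPN_scal (n : nat) (s : R) (f : R -> R) : InPN n f -> InPN n (fun x => s * f x).
Proof.
  intros [c Hc]; exists (fun k => s * c k); intros x.
  rewrite Hc, sum_f_R0_scal. apply sum_eq; intros; ring.
Qed.

Lemma InPN_minus (n : nat) (f g : R -> R) :
  InPN n f -> InPN n g -> InPN n (fun x => f x - g x).
Proof.
  intros Hf Hg. eapply InPN_ext; [|apply (InPN_plus _ _ _ Hf (InPN_scal _ (-1) _ Hg))].
  intros x; simpl; ring.
Qed.

Lemma InPN_mono (n m : nat) (f : R -> R) : (n <= m)%nat -> InPN n f -> InPN m f.
Proof.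
  intros Hnm [c Hc]; exists (fun k => if le_lt_dec k n then c k else 0); intros x.
  rewrite (sum_f_R0_trunc _ n m Hnm).
  - rewrite Hc. apply sum_eq; intros k Hk. destruct (le_lt_dec k n); [reflexivity|lia].
  - intros k Hk. destruct (le_lt_dec k n); [lia|ring].
Qed.

Lemma InPN_const (n : nat) (s : R) : InPN n (fun _ => s).
Proof.
  apply (InPN_mono 0); [lia|]. exists (fun _ => s). intros x; simpl; ring.
Qed.

Lemma InPN_mulX (n : nat) (f : R -> R) : InPN n f -> InPN (S n) (fun x => x * f x).
Proof.
  intros [c Hc]; exists (fun k => match k with O => 0 | S k' => c k' end); intros x.
  rewrite decomp_sum by lia. simpl pred. rewrite Hc, sum_f_R0_scal, Rmult_0_l, Rplus_0_l.
  apply sum_eq; intros; simpl; ring.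
Qed.

Lemma InPN_sum (n m : nat) (f : nat -> R -> R) :
  (forall k, (k <= m)%nat -> InPN n (f k)) ->
  InPN n (fun x => sum_f_R0 (fun k => f k x) m).
Proof.
  intros H; induction m as [|m IH]; simpl; [apply H; lia|].
  apply InPN_plus; [apply IH; intros; apply H; lia|apply H; lia].
Qed.

Lemma InPN_monomial_mul (n k : nat) (f : R -> R) :
  InPN n f -> InPN (k + n) (fun x => x ^ k * f x).
Proof.
  intros Hf; induction k as [|k IH]; simpl.
  - eapply InPN_ext; [|exact Hf]. intros x; simpl; ring.
  - eapply InPN_ext; [|apply InPN_mulX, IH]. intros x; simpl; ring.
Qed.

Lemma InPN_mul (n m : nat) (f g : R -> R) :
  InPN n f -> InPN m g -> InPN (n + m) (fun x => f x * g x).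
Proof.
  intros [c Hc] Hg.
  eapply InPN_ext with (fun x => sum_f_R0 (fun k => c k * (x ^ k * g x)) n).
  - intros x. rewrite Hc, Rmult_comm, sum_f_R0_scal. apply sum_eq; intros; ring.
  - apply InPN_sum. intros k Hk. apply InPN_scal.
    apply (InPN_mono (k + m)); [lia|apply InPN_monomial_mul, Hg].
Qed.

Lemma InPN_affine_pow (s h : R) (k : nat) : InPN k (fun x => (s * x + h) ^ k).
Proof.
  induction k as [|k IH]; [apply (InPN_const 0 1)|].
  apply (InPN_mul 1 k (fun x => s * x + h)); [|exact IH].
  exists (fun k => match k with O => h | _ => s end). intros x; simpl; ring.
Qed.

Lemma InPN_comp_affine (n : nat) (s h : R) (f : R -> R) :
  InPN n f -> InPN n (fun x => f (s * x + h)).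
Proof.
  intros [c Hc].
  eapply InPN_ext with (fun x => sum_f_R0 (fun k => c k * (s * x + h) ^ k) n).
  - intros x; rewrite Hc; reflexivity.
  - apply InPN_sum. intros k Hk. apply InPN_scal, (InPN_mono k); [exact Hk|].
    apply InPN_affine_pow.
Qed.

Lemma InPN_factor (n : nat) (f : R -> R) (r : R) : InPN (S n) f -> f r = 0 ->
  exists g, InPN n g /\ forall x, f x = (x - r) * g x.
Proof.
  intros [c Hc] Hr.
  assert (Hpow : forall k, exists g, InPN k g /\ forall x, x ^ S k - r ^ S k = (x - r) * g x).
  { induction k as [|k [g [Hg Eg]]].
    - exists (fun _ => 1); split; [apply InPN_const|intros; simpl; ring].
    - exists (fun x => x * g x + r ^ S k); split.
      + apply InPN_plus; [apply InPN_mulX, Hg|apply InPN_const].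
      + intros x. replace (x ^ S (S k) - r ^ S (S k))
          with (x * (x ^ S k - r ^ S k) + (x - r) * r ^ S k) by (simpl; ring).
        rewrite Eg; ring. }
  (* The quotient of each x^(k+1) - r^(k+1) is only known to exist; choice gathers them into one
     family that can be summed. *)
  set (G := fun k => proj1_sig (constructive_indefinite_description _ (Hpow k))).
  assert (HG : forall k, InPN k (G k) /\ forall x, x ^ S k - r ^ S k = (x - r) * G k x)
    by (intros k; exact (proj2_sig (constructive_indefinite_description _ (Hpow k)))).
  exists (fun x => sum_f_R0 (fun k => c (S k) * G k x) n); split.
  - apply InPN_sum. intros k Hk. apply InPN_scal, (InPN_mono k); [exact Hk|apply HG].
  - intros x. rewrite sum_f_R0_scal.
    replace (f x) with (f x - f r) by (rewrite Hr; ring).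
    rewrite !Hc, (decomp_sum (fun k => c k * x ^ k)), (decomp_sum (fun k => c k * r ^ k)) by lia.
    simpl pred. replace (c O * x ^ 0 + sum_f_R0 (fun i => c (S i) * x ^ S i) n
      - (c O * r ^ 0 + sum_f_R0 (fun i => c (S i) * r ^ S i) n))
      with (sum_f_R0 (fun i => c (S i) * x ^ S i) n
            - sum_f_R0 (fun i => c (S i) * r ^ S i) n) by (simpl; ring).
    rewrite <- minus_sum. apply sum_eq; intros k Hk.
    rewrite <- Rmult_minus_distr_l, (proj2 (HG k)). ring.
Qed.

Lemma InPN_roots (n : nat) (f : R -> R) (xs : nat -> R) : InPN n f ->
  (forall i j, (i <= n)%nat -> (j <= n)%nat -> xs i = xs j -> i = j) ->
  (forall i, (i <= n)%nat -> f (xs i) = 0) -> forall x, f x = 0.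
Proof.
  revert f; induction n as [|n IH]; intros f Hf Hinj H0 x.
  - destruct Hf as [c Hc]. specialize (H0 O ltac:(lia)). rewrite Hc in H0 |- *.
    simpl in *; lra.
  - destruct (InPN_factor n f (xs (S n)) Hf (H0 (S n) ltac:(lia))) as [g [Hg Eg]].
    rewrite Eg, (IH g Hg); [ring|..].
    + intros i j Hi Hj; apply Hinj; lia.
    + intros i Hi. specialize (H0 i ltac:(lia)). rewrite Eg in H0.
      apply Rmult_integral in H0 as [H0|H0]; [|exact H0].
      assert (i = S n) by (apply Hinj; [lia|lia|lra]). lia.
Qed.

(** The value at 0 gives the constant coefficient; the quotient by x then vanishes at the n + 1
    positive integers 1, ..., n + 1, and the induction continues with it. *)
Lemma poly_zero_coef (n : nat) (c : nat -> R) :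
  (forall x, sum_f_R0 (fun k => c k * x ^ k) n = 0) -> forall k, (k <= n)%nat -> c k = 0.
Proof.
  revert c; induction n as [|n IH]; intros c H k Hk.
  - replace k with O by lia. specialize (H 0). simpl in H; lra.
  - assert (H0 : c O = 0).
    { specialize (H 0). rewrite decomp_sum in H by lia. rewrite sum_f_R0_zero in H.
      - simpl in H; lra.
      - intros i _; simpl; ring. }
    destruct k as [|k]; [exact H0|].
    apply (IH (fun k => c (S k))); [|lia].
    apply (InPN_roots n _ (fun i => INR (S i))).
    + exists (fun k => c (S k)); reflexivity.
    + intros i j _ _ E. apply INR_eq in E. lia.
    + intros i _. specialize (H (INR (S i))). rewrite decomp_sum in H by lia.
      rewrite H0, Rmult_0_l, Rplus_0_l in H. simpl pred in H.
      assert (E : INR (S i) * sum_f_R0 (fun k => c (S k) * INR (S i) ^ k) n = 0).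
      { rewrite <- H, sum_f_R0_scal. apply sum_eq; intros; rewrite <- tech_pow_Rmult; ring. }
      apply Rmult_integral in E as [E|E]; [|exact E].
      pose proof (lt_0_INR (S i) ltac:(lia)); lra.
Qed.

Lemma Lagrange_basis_exists (N j : nat) (xs : nat -> R) : (1 <= N)%nat -> (j <= N)%nat ->
  (forall i k, (i <= N)%nat -> (k <= N)%nat -> xs i = xs k -> i = k) ->
  exists h, InPN N h /\ forall i, (i <= N)%nat -> h (xs i) = if Nat.eqb i j then 1 else 0.
Proof.
  intros HN Hj Hinj.
  (* The induction multiplies in the factors of all nodes below [m] except the j-th, so the degree
     bound drops by one once j has been passed. *)
  assert (Hprod : forall m, (m <= S N)%nat -> exists h,
    InPN (if le_lt_dec m j then m else m - 1) h /\ h (xs j) = 1 /\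
    forall i, (i < m)%nat -> i <> j -> h (xs i) = 0).
  { induction m as [|m IH]; intros Hm.
    - exists (fun _ => 1); split; [apply InPN_const|split; [reflexivity|lia]].
    - destruct (IH ltac:(lia)) as [h [Hh [H1 H0]]].
      destruct (Nat.eq_dec m j) as [->|Hne].
      + exists h. split; [|split; [exact H1|intros i Hi Hi'; apply H0; lia]].
        destruct (le_lt_dec j j); [|lia]. destruct (le_lt_dec (S j) j); [lia|].
        eapply InPN_mono; [|exact Hh]; lia.
      + assert (Hd : xs j - xs m <> 0).
        { intros E. apply Hne, Hinj; [lia|lia|lra]. }
        exists (fun x => / (xs j - xs m) * (1 * x + - xs m) ^ 1 * h x).
        split; [|split].
        * eapply InPN_mono; [|apply (InPN_mul 1); [apply InPN_scal, InPN_affine_pow|exact Hh]].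
          destruct (le_lt_dec m j), (le_lt_dec (S m) j); lia.
        * rewrite H1. field. exact Hd.
        * intros i Hi Hi'. destruct (Nat.eq_dec i m) as [->|Him]; [ring|].
          rewrite H0 by lia. ring. }
  destruct (Hprod (S N) ltac:(lia)) as [h [Hh [H1 H0]]].
  exists h; split.
  - destruct (le_lt_dec (S N) j); [lia|]. eapply InPN_mono; [|exact Hh]; lia.
  - intros i Hi. destruct (Nat.eqb_spec i j) as [->|Hne]; [exact H1|apply H0; lia].
Qed.

(** * Jacobi polynomials *)

(** Coefficients in powers of (1 - x)/2. The quotient of Gamma values in [Jacobi] becomes a
    Pochhammer symbol, which makes identities between coefficients rational. *)
Definition jacobi_coef (a b : R) (n k : nat) : R :=
  poch (a + 1) n / INR (fact n)
  * (poch (- INR n) k * poch (INR n + a + b + 1) k / (poch (a + 1) k * INR (fact k))).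

(** The classical formula for the derivative. It is again a Jacobi polynomial, with both parameters
    raised and the degree lowered, so inductions on the degree below let the parameters vary. *)
Definition dJacobi (a b : R) (n : nat) (x : R) : R :=
  match n with
  | O => 0
  | S m => (INR n + a + b + 1) / 2 * Jacobi (a + 1) (b + 1) m x
  end.

Definition ddJacobi (a b : R) (n : nat) (x : R) : R :=
  match n with
  | O => 0
  | S m => (INR n + a + b + 1) / 2 * dJacobi (a + 1) (b + 1) m x
  end.

Lemma dJacobi_S (a b : R) (n : nat) (x : R) :
  dJacobi a b (S n) x = (INR (S n) + a + b + 1) / 2 * Jacobi (a + 1) (b + 1) n x.
Proof. reflexivity. Qed.

Lemma Jacobi_sum (a b : R) (n : nat) (x : R) : -1 < a ->
  Jacobi a b n x = sum_f_R0 (fun k => jacobi_coef a b n k * ((1 - x) / 2) ^ k) n.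
Proof.
  intros Ha. unfold Jacobi.
  replace (INR n + a + 1) with (a + 1 + INR n) by ring.
  rewrite Gamma_add_INR by lra. pose proof (Gamma_pos (a + 1) ltac:(lra)).
  rewrite sum_f_R0_scal. apply sum_eq; intros k Hk. unfold jacobi_coef.
  pose proof (INR_fact_lt_0 n). pose proof (INR_fact_lt_0 k).
  pose proof (poch_pos (a + 1) k ltac:(lra)). field. repeat split; lra.
Qed.

Lemma Jacobi_0 (a b x : R) : -1 < a -> Jacobi a b 0 x = 1.
Proof.
  intros Ha. rewrite Jacobi_sum by exact Ha. unfold jacobi_coef; simpl. field.
Qed.

Lemma jacobi_coef_derive (a b : R) (n k : nat) : -1 < a ->
  INR (S k) * jacobi_coef a b (S n) (S k)
  = - (INR (S n) + a + b + 1) * jacobi_coef (a + 1) (b + 1) n k.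
Proof.
  intros Ha. unfold jacobi_coef.
  rewrite !poch_S_left, !fact_simpl, !mult_INR.
  replace (- INR (S n) + 1) with (- INR n) by (rewrite S_INR; ring).
  replace (INR (S n) + a + b + 1 + 1) with (INR n + (a + 1) + (b + 1) + 1)
    by (rewrite S_INR; ring).
  pose proof (INR_fact_lt_0 n). pose proof (INR_fact_lt_0 k).
  pose proof (poch_pos (a + 1 + 1) k ltac:(lra)).
  pose proof (lt_0_INR (S n) ltac:(lia)). pose proof (lt_0_INR (S k) ltac:(lia)).
  field. repeat split; lra.
Qed.

Lemma is_derive_t_pow (x : R) (k : nat) :
  is_derive (fun y => ((1 - y) / 2) ^ k) x (- / 2 * (INR k * ((1 - x) / 2) ^ pred k)).
Proof. auto_derive; [exact I|]. unfold Rdiv, Rminus. ring. Qed.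

Lemma is_derive_t_sum (c : nat -> R) (n : nat) (x : R) :
  is_derive (fun y => sum_f_R0 (fun k => c k * ((1 - y) / 2) ^ k) n) x
    (sum_f_R0 (fun k => c k * (- / 2 * (INR k * ((1 - x) / 2) ^ pred k))) n).
Proof.
  apply is_derive_sum_f_R0. intros k _. apply is_derive_scal, is_derive_t_pow.
Qed.

Lemma dJacobi_sum (a b : R) (n : nat) (x : R) : -1 < a ->
  dJacobi a b n x
  = sum_f_R0 (fun k => jacobi_coef a b n k * (- / 2 * (INR k * ((1 - x) / 2) ^ pred k))) n.
Proof.
  intros Ha. destruct n as [|n]; [simpl; ring|].
  rewrite decomp_sum by lia. simpl pred. rewrite Rmult_0_l, !Rmult_0_r, Rplus_0_l.
  rewrite dJacobi_S, Jacobi_sum, sum_f_R0_scal by lra. apply sum_eq; intros k Hk.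
  transitivity (- / 2 * (INR (S k) * jacobi_coef a b (S n) (S k)) * ((1 - x) / 2) ^ k);
    [|simpl pred; ring].
  rewrite jacobi_coef_derive by exact Ha. field.
Qed.

Lemma is_derive_Jacobi (a b : R) (n : nat) (x : R) : -1 < a ->
  is_derive (Jacobi a b n) x (dJacobi a b n x).
Proof.
  intros Ha. rewrite dJacobi_sum by exact Ha.
  eapply is_derive_ext; [|apply is_derive_t_sum].
  intros t; simpl. rewrite <- Jacobi_sum by exact Ha. reflexivity.
Qed.

Lemma is_derive_dJacobi (a b : R) (n : nat) (x : R) : -1 < a ->
  is_derive (dJacobi a b n) x (ddJacobi a b n x).
Proof.
  intros Ha. destruct n as [|n]; [apply (is_derive_const (V := R_NormedModule))|].
  apply is_derive_scal, is_derive_Jacobi; lra.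
Qed.

Lemma continuous_Jacobi (a b : R) (n : nat) (x : R) : -1 < a -> continuous (Jacobi a b n) x.
Proof.
  intros Ha. apply (ex_derive_continuous (Jacobi a b n)). eexists; apply is_derive_Jacobi, Ha.
Qed.

Lemma continuous_dJacobi (a b : R) (n : nat) (x : R) : -1 < a -> continuous (dJacobi a b n) x.
Proof.
  intros Ha. apply (ex_derive_continuous (dJacobi a b n)). eexists; apply is_derive_dJacobi, Ha.
Qed.

Lemma continuous_ddJacobi (a b : R) (n : nat) (x : R) : -1 < a -> continuous (ddJacobi a b n) x.
Proof.
  intros Ha. destruct n as [|n]; [apply continuous_const|].
  apply (ex_derive_continuous (ddJacobi a b (S n))).
  eexists; apply is_derive_scal, is_derive_dJacobi; lra.
Qed.

Lemma ddJacobi_sum (a b : R) (n : nat) (x : R) : -1 < a ->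
  ddJacobi a b n x = sum_f_R0 (fun k => jacobi_coef a b n k
    * (/ 4 * (INR k * (INR (pred k) * ((1 - x) / 2) ^ pred (pred k))))) n.
Proof.
  intros Ha.
  assert (H1 := is_derive_dJacobi a b n x Ha).
  apply is_derive_unique in H1. rewrite <- H1. apply is_derive_unique.
  eapply is_derive_ext; [intros t; symmetry; apply (dJacobi_sum a b n t Ha)|].
  apply is_derive_sum_f_R0. intros k _. apply is_derive_scal.
  replace (/ 4 * (INR k * (INR (pred k) * ((1 - x) / 2) ^ pred (pred k))))
    with (- / 2 * (INR k * (- / 2 * (INR (pred k) * ((1 - x) / 2) ^ pred (pred k))))) by field.
  do 2 apply is_derive_scal. apply is_derive_t_pow.
Qed.

(** The term ratio of the hypergeometric series. It drives the telescoping in the differential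
    equation, and its factor [INR k - INR n] makes the remainder vanish at k = n. *)
Lemma jacobi_coef_rec (a b : R) (n k : nat) : -1 < a ->
  INR (S k) * (INR (S k) + a) * jacobi_coef a b n (S k)
  = (INR k - INR n) * (INR k + INR n + a + b + 1) * jacobi_coef a b n k.
Proof.
  intros Ha. unfold jacobi_coef. rewrite !fact_simpl, !mult_INR. simpl poch.
  pose proof (INR_fact_lt_0 n). pose proof (INR_fact_lt_0 k).
  pose proof (poch_pos (a + 1) k ltac:(lra)). pose proof (pos_INR k).
  rewrite !S_INR. field. repeat split; lra.
Qed.

Lemma Jacobi_ODE (a b : R) (n : nat) (x : R) : -1 < a ->
  (1 - x ^ 2) * ddJacobi a b n x + (b - a - (a + b + 2) * x) * dJacobi a b n x
  + INR n * (INR n + a + b + 1) * Jacobi a b n x = 0.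
Proof.
  intros Ha. rewrite ddJacobi_sum, dJacobi_sum, Jacobi_sum by exact Ha.
  rewrite !sum_f_R0_scal, <- !plus_sum.
  set (t := (1 - x) / 2). replace x with (1 - 2 * t) by (unfold t; field). clearbody t.
  (* telescoping partial sums *)
  assert (H : forall m, sum_f_R0 (fun k =>
     (1 - (1 - 2 * t) ^ 2) * (jacobi_coef a b n k
        * (/ 4 * (INR k * (INR (pred k) * t ^ pred (pred k)))))
     + (b - a - (a + b + 2) * (1 - 2 * t)) * (jacobi_coef a b n k
        * (- / 2 * (INR k * t ^ pred k)))
     + INR n * (INR n + a + b + 1) * (jacobi_coef a b n k * t ^ k)) m
     = (INR n - INR m) * (INR m + INR n + a + b + 1) * jacobi_coef a b n m * t ^ m).
  { induction m as [|m IH].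
    - simpl. ring.
    - rewrite tech5, IH.
      replace ((INR n - INR m) * (INR m + INR n + a + b + 1) * jacobi_coef a b n m * t ^ m)
        with (- ((INR m - INR n) * (INR m + INR n + a + b + 1) * jacobi_coef a b n m) * t ^ m)
        by ring.
      rewrite <- jacobi_coef_rec by exact Ha. simpl pred.
      destruct m as [|m].
      + simpl. field.
      + rewrite !S_INR. simpl. field. }
  rewrite H. ring.
Qed.

Lemma fun_eq_of_derive (f g d : R -> R) (x0 : R) :
  (forall x, is_derive f x (d x)) -> (forall x, is_derive g x (d x)) ->
  f x0 = g x0 -> forall x, f x = g x.
Proof.
  intros Hf Hg H0 x.
  assert (Hd : forall y, is_derive (fun z => f z - g z) y (zero (G := R_NormedModule))).
  { intros y. eapply eq_rect; [apply (is_derive_minus f g y); [apply Hf|apply Hg]|].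
    apply (minus_eq_zero (G := R_NormedModule)). }
  destruct (Rtotal_order x x0) as [H|[->|H]]; [|exact H0|].
  - assert (E := eq_is_derive (V := R_NormedModule) _ x x0 (fun t _ => Hd t) H). simpl in E. lra.
  - assert (E := eq_is_derive (V := R_NormedModule) _ x0 x (fun t _ => Hd t) H). simpl in E. lra.
Qed.

Lemma Jacobi_at_1 (a b : R) (n : nat) : -1 < a ->
  Jacobi a b n 1 = poch (a + 1) n / INR (fact n).
Proof.
  intros Ha. rewrite Jacobi_sum by exact Ha.
  rewrite (sum_f_R0_single _ n 0); [|lia|].
  - unfold jacobi_coef; simpl. pose proof (INR_fact_lt_0 n). field; lra.
  - intros k _ Hk. destruct k as [|k]; [lia|]. simpl. unfold Rdiv. ring.
Qed.

(** At -1 the second-order term of the differential equation drops out. What remains expresses the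
    value through the first derivative, a Jacobi polynomial of lower degree, so induction replaces
    the Chu-Vandermonde summation. *)
Lemma Jacobi_at_m1 (a b : R) (n : nat) : -1 < a -> -1 < b ->
  Jacobi a b n (-1) = (-1) ^ n * (poch (b + 1) n / INR (fact n)).
Proof.
  revert a b; induction n as [|n IH]; intros a b Ha Hb.
  - rewrite Jacobi_0 by exact Ha. simpl. field.
  - assert (H := Jacobi_ODE a b (S n) (-1) Ha). rewrite dJacobi_S, IH in H by lra. rewrite poch_S_left, fact_simpl, mult_INR.
    pose proof (INR_fact_lt_0 n). pose proof (lt_0_INR (S n) ltac:(lia)).
    assert (0 < INR (S n) + a + b + 1) by (rewrite S_INR; pose proof (pos_INR n); lra).
    apply Rmult_eq_reg_l with (INR (S n) * (INR (S n) + a + b + 1)); [|nra].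
    replace (1 - (-1) ^ 2) with 0 in H by ring.
    transitivity (- ((b - a - (a + b + 2) * -1) *
      ((INR (S n) + a + b + 1) / 2 * ((-1) ^ n * (poch (b + 1 + 1) n / INR (fact n)))))); [lra|].
    simpl pow. field. split; lra.
Qed.

(** Both sides have the same derivative, by induction with raised parameters, and the same value at
    -1. *)
Lemma Jacobi_reflect (a b : R) (n : nat) (x : R) : -1 < a -> -1 < b ->
  Jacobi a b n x = (-1) ^ n * Jacobi b a n (- x).
Proof.
  revert a b x; induction n as [|n IH]; intros a b x Ha Hb.
  - rewrite !Jacobi_0 by assumption. simpl; ring.
  - revert x. apply fun_eq_of_derive with (dJacobi a b (S n)) (-1).
    + intros x; apply is_derive_Jacobi, Ha.
    + intros x. rewrite dJacobi_S, IH by lra.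
      assert (H := is_derive_scal _ x ((-1) ^ S n) _
        (is_derive_comp (Jacobi b a (S n)) (fun y => - y) x _ (-1)
          (is_derive_Jacobi b a (S n) (- x) Hb) ltac:(auto_derive; [exact I|ring]))).
      eapply eq_rect; [exact H|]. unfold scal; simpl. unfold mult; simpl.
      field.
    + rewrite Jacobi_at_m1 by assumption.
      replace (- -1) with 1 by ring. rewrite Jacobi_at_1 by assumption. reflexivity.
Qed.

Lemma Jacobi_sum_m1 (a b : R) (n : nat) (x : R) : -1 < a -> -1 < b ->
  Jacobi a b n x
  = sum_f_R0 (fun k => (-1) ^ n * jacobi_coef b a n k / 2 ^ k * (1 + x) ^ k) n.
Proof.
  intros Ha Hb. rewrite Jacobi_reflect, Jacobi_sum, sum_f_R0_scal by assumption.
  apply sum_eq; intros k Hk. replace ((1 - - x) / 2) with ((1 + x) * / 2) by field.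
  rewrite Rpow_mult_distr, pow_inv. field. apply pow_nonzero; lra.
Qed.

Lemma sum_f_R0_pos (f : nat -> R) (n : nat) :
  0 < f O -> (forall k, 0 <= f k) -> 0 < sum_f_R0 f n.
Proof.
  intros H0 H. destruct n as [|n]; [exact H0|]. rewrite decomp_sum by lia.
  apply Rplus_lt_le_0_compat; [exact H0|]. apply cond_pos_sum. intros k; apply H.
Qed.

(** After reflection all terms of the expansion are nonnegative and the first is positive. Applied
    to the derivative, this excludes nodes to the left of -1. *)
Lemma Jacobi_neq_0_left (a b : R) (n : nat) (x : R) : -1 < a -> -1 < b ->
  (n = O \/ 0 < INR n + a + b + 1) -> x < -1 -> Jacobi a b n x <> 0.
Proof.
  intros Ha Hb Hn Hx. rewrite Jacobi_reflect, Jacobi_sum by assumption.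
  apply Rmult_integral_contrapositive_currified; [apply pow_nonzero; lra|].
  apply Rgt_not_eq. unfold Rgt.
  pose proof (INR_fact_lt_0 n). pose proof (poch_pos (b + 1) n ltac:(lra)).
  assert (Hpos : forall k, 0 <= jacobi_coef b a n k * ((1 - - x) / 2) ^ k).
  { intros k. unfold jacobi_coef.
    assert (Hs := poch_opp_INR_sign n k ((1 - - x) / 2) ltac:(lra)).
    pose proof (INR_fact_lt_0 k). pose proof (poch_pos (b + 1) k ltac:(lra)).
    assert (Hq : poch (- INR n) k = 0 \/ 0 < poch (INR n + b + a + 1) k).
    { destruct Hn as [->|Hn]; [|right; apply poch_pos; lra].
      destruct k as [|k]; [right; simpl; lra|left; apply poch_opp_INR_0; lia]. }
    destruct Hq as [Hq|Hq].
    - rewrite Hq. unfold Rdiv. rewrite !Rmult_0_l, Rmult_0_r, Rmult_0_l. lra.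
    - replace (poch (b + 1) n / INR (fact n) *
        (poch (- INR n) k * poch (INR n + b + a + 1) k / (poch (b + 1) k * INR (fact k)))
        * ((1 - - x) / 2) ^ k)
      with ((poch (b + 1) n / INR (fact n)
         * (poch (INR n + b + a + 1) k / (poch (b + 1) k * INR (fact k))))
         * (poch (- INR n) k * ((1 - - x) / 2) ^ k)) by (field; lra).
      apply Rmult_le_pos; [|exact Hs].
      apply Rlt_le, Rmult_lt_0_compat; apply Rdiv_lt_0_compat; try assumption.
      apply Rmult_lt_0_compat; assumption. }
  apply sum_f_R0_pos; [|exact Hpos].
  unfold jacobi_coef; simpl.
  replace (poch (b + 1) n / INR (fact n) * (1 * 1 / (1 * 1)) * 1)
    with (poch (b + 1) n / INR (fact n)) by (field; lra).
  apply Rdiv_lt_0_compat; assumption.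
Qed.

Lemma InPN_t_pow (k : nat) : InPN k (fun x => ((1 - x) / 2) ^ k).
Proof.
  eapply InPN_ext; [|apply (InPN_affine_pow (- / 2) (/ 2) k)].
  intros x; simpl; f_equal; field.
Qed.

Lemma InPN_Jacobi (a b : R) (n : nat) : -1 < a -> InPN n (Jacobi a b n).
Proof.
  intros Ha. eapply InPN_ext; [intros x; symmetry; apply Jacobi_sum, Ha|].
  apply InPN_sum. intros k Hk. apply InPN_scal, (InPN_mono k); [exact Hk|apply InPN_t_pow].
Qed.

Lemma InPN_dJacobi (a b : R) (n : nat) : -1 < a -> InPN (n - 1) (dJacobi a b n).
Proof.
  intros Ha. destruct n as [|n]; [apply InPN_const|].
  simpl. rewrite Nat.sub_0_r. apply InPN_scal, InPN_Jacobi; lra.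
Qed.

(** With x = 1 - 2t, the coefficient of t^k acquires the factor k - n, which removes the only term
    of degree n. *)
Lemma InPN_X_dJacobi (a b : R) (n : nat) : -1 < a -> (1 <= n)%nat ->
  InPN (n - 1) (fun x => x * dJacobi a b n x - INR n * Jacobi a b n x).
Proof.
  intros Ha Hn.
  eapply InPN_ext with (fun x => sum_f_R0 (fun k => (INR k - INR n) * jacobi_coef a b n k
      * ((1 - x) / 2) ^ k + - (INR k / 2) * jacobi_coef a b n k * ((1 - x) / 2) ^ pred k) n).
  - intros x. rewrite dJacobi_sum, Jacobi_sum, !sum_f_R0_scal, <- minus_sum by exact Ha.
    apply sum_eq; intros k _. set (t := (1 - x) / 2).
    replace x with (1 - 2 * t) by (unfold t; field).
    destruct k as [|k]; [simpl; field|]. simpl pred. rewrite <- tech_pow_Rmult. field.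
  - apply InPN_sum. intros k Hk. apply InPN_plus.
    + destruct (Nat.eq_dec k n) as [->|Hne].
      * eapply InPN_ext; [|apply (InPN_const _ 0)]. intros x; simpl; ring.
      * apply InPN_scal, (InPN_mono k); [lia|apply InPN_t_pow].
    + apply InPN_scal, (InPN_mono (pred k)); [lia|apply InPN_t_pow].
Qed.

Lemma t_pow_lead (n : nat) : exists r, InPN n r /\
  forall x, ((1 - x) / 2) ^ S n = (- / 2) ^ S n * x ^ S n + r x.
Proof.
  induction n as [|n [r [Hr Er]]].
  - exists (fun _ => / 2); split; [apply InPN_const|]. intros x; simpl; field.
  - exists (fun x => (/ 2 * (- / 2) ^ S n) * (1 * x + 0) ^ S n + (/ 2 * r x + - / 2 * (x * r x))).
    split.
    + apply InPN_plus; [apply InPN_scal, InPN_affine_pow|].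
      apply InPN_plus; apply InPN_scal.
      * apply (InPN_mono n); [lia|exact Hr].
      * apply InPN_mulX, Hr.
    + intros x. rewrite <- tech_pow_Rmult, Er, <- (tech_pow_Rmult _ (S n)), <- (tech_pow_Rmult x (S n)).
      replace (1 * x + 0) with x by ring. field.
Qed.

Lemma InPN_Jacobi_basis (a b : R) (n : nat) (f : R -> R) : -1 < a -> -1 < b ->
  InPN n f -> exists d, forall x, f x = sum_f_R0 (fun k => d k * Jacobi a b k x) n.
Proof.
  intros Ha Hb; revert f; induction n as [|n IH]; intros f [c Hc].
  - exists c. intros x. rewrite Hc. simpl. rewrite Jacobi_0 by exact Ha. ring.
  - destruct (t_pow_lead n) as [r [Hr Er]].
    (* The leading coefficient of [Jacobi a b (S n)]. It is nonzero because n + a + b + 2 > 0, so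
       the change to the Jacobi basis is triangular and invertible. *)
    set (kap := jacobi_coef a b (S n) (S n) * (- / 2) ^ S n).
    assert (Hkap : kap <> 0).
    { unfold kap, jacobi_coef. pose proof (INR_fact_lt_0 (S n)).
      pose proof (poch_pos (a + 1) (S n) ltac:(lra)).
      assert (0 < poch (INR (S n) + a + b + 1) (S n))
        by (apply poch_pos; rewrite S_INR; pose proof (pos_INR n); lra).
      assert (poch (- INR (S n)) (S n) <> 0).
      { assert (G : forall m k, (k <= m)%nat -> poch (- INR m) k <> 0).
        { intros m; induction k as [|k IHk]; intros Hk; simpl; [lra|].
          apply Rmult_integral_contrapositive_currified; [apply IHk; lia|].
          pose proof (lt_INR k m ltac:(lia)); lra. }
        apply G; lia. }
      apply Rmult_integral_contrapositive_currified; [|apply pow_nonzero; lra].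
      apply Rmult_integral_contrapositive_currified;
        [apply Rgt_not_eq, Rdiv_lt_0_compat; assumption|].
      apply Rmult_integral_contrapositive_currified.
      - apply Rmult_integral_contrapositive_currified; [assumption|lra].
      - apply Rinv_neq_0_compat, Rgt_not_eq, Rmult_lt_0_compat; assumption. }
    set (s := fun x => sum_f_R0 (fun k => jacobi_coef a b (S n) k * ((1 - x) / 2) ^ k) n
                       + jacobi_coef a b (S n) (S n) * r x).
    assert (Hs : InPN n s).
    { apply InPN_plus; [|apply InPN_scal, Hr]. apply InPN_sum. intros k Hk.
      apply InPN_scal, (InPN_mono k); [exact Hk|apply InPN_t_pow]. }
    assert (EP : forall x, Jacobi a b (S n) x = kap * x ^ S n + s x).
    { intros x. rewrite Jacobi_sum by exact Ha. simpl sum_f_R0.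
      change (((1 - x) / 2) * ((1 - x) / 2) ^ n) with (((1 - x) / 2) ^ S n).
      rewrite Er. unfold s, kap. ring. }
    destruct (IH (fun x => sum_f_R0 (fun k => c k * x ^ k) n - c (S n) / kap * s x)) as [d Hd].
    { apply InPN_minus; [exists c; reflexivity|apply InPN_scal, Hs]. }
    exists (fun k => if Nat.eqb k (S n) then c (S n) / kap else d k). intros x.
    cbn [sum_f_R0]. rewrite Nat.eqb_refl, EP.
    rewrite (sum_eq _ (fun k => d k * Jacobi a b k x)).
    + rewrite <- Hd, Hc. cbn [sum_f_R0]. field. exact Hkap.
    + intros k Hk. destruct (Nat.eqb_spec k (S n)); [lia|reflexivity].
Qed.

(** * Orthogonality *)

Lemma ImproperInt_poly_weight (a b : R) (n : nat) (phi : R -> R) : -1 < a -> -1 < b ->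
  (exists L, ImproperInt (weight (-1) 1 a b) (-1) 1 L) -> InPN n phi ->
  exists L, ImproperInt (fun y => phi y * weight (-1) 1 a b y) (-1) 1 L.
Proof.
  intros Ha Hb Hw [c Hc].
  (* Since y^(k+1) = (y + 1) y^k - y^k, one more power of y costs an increase of the exponent b; the
     induction therefore quantifies over b. *)
  assert (Hmon : forall k b, -1 < b ->
    (exists L, ImproperInt (weight (-1) 1 a b) (-1) 1 L) ->
    exists L, ImproperInt (fun y => y ^ k * weight (-1) 1 a b y) (-1) 1 L).
  { clear b Hb Hw. induction k as [|k IH]; intros b Hb [L HL].
    - exists L. eapply ImproperInt_ext; [|exact HL]. intros y _; simpl; ring.
    - destruct (IH b Hb) as [M HM]; [exists L; exact HL|].
      destruct (IH (b + 1)) as [M' HM']; [lra| |].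
      { eexists. apply ImproperInt_weight_succ_r; [lra|exact Ha|exact Hb|exact HL]. }
      eexists. eapply ImproperInt_ext; [|apply (ImproperInt_lin _ _ _ _ _ _ 1 (-1) HM' HM)].
      intros y Hy. cbv beta. rewrite weight_succ_r by lra. simpl. ring. }
  assert (Hsum : forall m, exists L, ImproperInt (fun y =>
      sum_f_R0 (fun k => c k * y ^ k) m * weight (-1) 1 a b y) (-1) 1 L).
  { induction m as [|m [L HL]].
    - destruct (Hmon O b Hb Hw) as [M HM]. eexists.
      eapply ImproperInt_ext; [|apply (ImproperInt_lin _ _ _ _ _ _ (c O) 0 HM HM)].
      intros y _; simpl; ring.
    - destruct (Hmon (S m) b Hb Hw) as [M HM]. eexists.
      eapply ImproperInt_ext; [|apply (ImproperInt_lin _ _ _ _ _ _ 1 (c (S m)) HL HM)].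
      intros y _; simpl; ring. }
  destruct (Hsum n) as [L HL]. exists L. eapply ImproperInt_ext; [|exact HL].
  intros y _; cbv beta. rewrite Hc; reflexivity.
Qed.

Definition jacobi_eigen (a b : R) (n : nat) : R := INR n * (INR n + a + b + 1).

(** Integration by parts with v = P_n' P_m, the second derivative being eliminated by the
    differential equation. The derivative term is symmetric in n and m, which yields orthogonality;
    the diagonal case yields the norms. *)
Lemma ImproperInt_Sturm_Liouville (a b : R) (n m : nat) : -1 < a -> -1 < b ->
  ImproperInt (fun y => ((1 - y ^ 2) * (dJacobi a b n y * dJacobi a b m y)
    - jacobi_eigen a b n * (Jacobi a b n y * Jacobi a b m y)) * weight (-1) 1 a b y) (-1) 1 0.
Proof.
  intros Ha Hb.
  eapply ImproperInt_ext; [|apply (ImproperInt_weight_by_parts (-1) 1 a b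
    (fun y => dJacobi a b n y * Jacobi a b m y)
    (fun y => ddJacobi a b n y * Jacobi a b m y + dJacobi a b n y * dJacobi a b m y));
    [lra|exact Ha|exact Hb|..]].
  - intros y _. cbv beta. f_equal. assert (H := Jacobi_ODE a b n y Ha). unfold jacobi_eigen.
    replace (INR n * (INR n + a + b + 1) * (Jacobi a b n y * Jacobi a b m y))
      with ((- ((1 - y ^ 2) * ddJacobi a b n y
                + (b - a - (a + b + 2) * y) * dJacobi a b n y)) * Jacobi a b m y); [ring|].
    rewrite <- Rmult_assoc. f_equal. lra.
  - intros y. apply (is_derive_mult (dJacobi a b n) (Jacobi a b m) y); [|apply is_derive_Jacobi, Ha|].
    + apply is_derive_dJacobi, Ha.
    + exact Rmult_comm.
  - intros y. apply (continuous_plus (V := R_NormedModule));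
      apply (continuous_mult (K := R_AbsRing)).
    + apply continuous_ddJacobi, Ha.
    + apply continuous_Jacobi, Ha.
    + apply continuous_dJacobi, Ha.
    + apply continuous_dJacobi, Ha.
Qed.

(** The identities for (n, m) and (m, n) differ by the difference of the eigenvalues times the
    integrand, so their difference can be divided by it. *)
Lemma ImproperInt_Jacobi_orthogonal (a b : R) (n m : nat) : -1 < a -> -1 < b -> n <> m ->
  ImproperInt (fun y => Jacobi a b n y * Jacobi a b m y * weight (-1) 1 a b y) (-1) 1 0.
Proof.
  intros Ha Hb Hnm.
  assert (Hl : jacobi_eigen a b m - jacobi_eigen a b n <> 0).
  { unfold jacobi_eigen.
    replace (INR m * (INR m + a + b + 1) - INR n * (INR n + a + b + 1))
      with ((INR m - INR n) * (INR m + INR n + a + b + 1)) by ring.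
    apply Rmult_integral_contrapositive_currified.
    - intros E. apply Hnm, INR_eq. lra.
    (* Distinct indices have sum at least 1, and a + b + 2 > 0, so this factor is positive even when
       a + b + 1 is negative. *)
    - rewrite <- plus_INR. pose proof (le_INR 1 (m + n) ltac:(lia)) as H1.
      simpl in H1. lra. }
  set (e := / (jacobi_eigen a b m - jacobi_eigen a b n)).
  replace 0 with (e * 0 + - e * 0) by ring.
  eapply ImproperInt_ext; [|apply ImproperInt_lin;
    [apply (ImproperInt_Sturm_Liouville a b n m Ha Hb)
    |apply (ImproperInt_Sturm_Liouville a b m n Ha Hb)]].
  intros y _. cbv beta. unfold e. field. exact Hl.
Qed.

(** The recursion that the norms satisfy: the squared derivative factor (n+a+b+1)^2/4, with n the
    raised index, divided by the eigenvalue n(n+a+b+1). The step from 0 is separate because [jgamma]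
    has another form there. *)
Lemma jgamma_S (a b : R) (n : nat) : -1 < a -> -1 < b ->
  jgamma a b (S n) = (INR (S n) + a + b + 1) / (4 * INR (S n)) * jgamma (a + 1) (b + 1) n.
Proof.
  intros Ha Hb.
  assert (E4 : forall c, Rpower 2 (c + 2) = 4 * Rpower 2 c).
  { intros c. rewrite Rpower_plus. replace (Rpower 2 2) with 4; [ring|].
    replace 2 with (1 + 1) at 2 by ring. rewrite Rpower_plus, Rpower_1 by lra. ring. }
  pose proof (pos_INR n).
  assert (HG : Gamma (INR (S n) + a + b + 1 + 1)
               = (INR (S n) + a + b + 1) * Gamma (INR (S n) + a + b + 1)).
  { apply Gamma_succ. rewrite S_INR; lra. }
  assert (0 < Gamma (INR (S n) + a + b + 1)) by (apply Gamma_pos; rewrite S_INR; lra).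
  unfold jgamma at 1. destruct n as [|n].
  - unfold jgamma. replace (a + 1 + (b + 1) + 1) with (a + b + 1 + 2) by ring. rewrite E4.
    replace (a + 1 + (b + 1) + 2) with (INR 1 + a + b + 1 + 1 + 1) by (simpl; ring).
    rewrite (Gamma_succ (INR 1 + a + b + 1 + 1)), HG by (simpl; lra).
    replace (INR 1 + a + 1) with (a + 1 + 1) by (simpl; ring).
    replace (INR 1 + b + 1) with (b + 1 + 1) by (simpl; ring).
    simpl INR in *. simpl fact. simpl INR. field. repeat split; lra.
  - unfold jgamma. replace (a + 1 + (b + 1) + 1) with (a + b + 1 + 2) by ring. rewrite E4.
    replace (INR (S n) + (a + 1) + (b + 1) + 1) with (INR (S (S n)) + a + b + 1 + 1)
      by (rewrite (S_INR (S n)); ring).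
    rewrite HG.
    replace (INR (S n) + (a + 1) + 1) with (INR (S (S n)) + a + 1) by (rewrite (S_INR (S n)); ring).
    replace (INR (S n) + (b + 1) + 1) with (INR (S (S n)) + b + 1) by (rewrite (S_INR (S n)); ring).
    rewrite (fact_simpl (S n)), mult_INR.
    pose proof (INR_fact_lt_0 (S n)). rewrite (S_INR (S n)) in *.
    field. repeat split; lra.
Qed.

Lemma jgamma_pos (a b : R) (n : nat) : -1 < a -> -1 < b -> 0 < jgamma a b n.
Proof.
  revert a b; induction n as [|n IH]; intros a b Ha Hb.
  - unfold jgamma. apply Rdiv_lt_0_compat; [|apply Gamma_pos; lra].
    repeat apply Rmult_lt_0_compat; try (apply Gamma_pos; lra). apply exp_pos.
  - rewrite jgamma_S by assumption. specialize (IH (a + 1) (b + 1) ltac:(lra) ltac:(lra)).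
    apply Rmult_lt_0_compat; [|exact IH]. pose proof (pos_INR n).
    rewrite S_INR. apply Rdiv_lt_0_compat; lra.
Qed.

(* [(1 - y^2) w^(a,b) = w^(a+1,b+1)] and [P_n' ~ P_(n-1)^(a+1,b+1)] turn the
   Sturm-Liouville identity into a recursion for the norms. *)
Lemma ImproperInt_Jacobi_norm (a b : R) (n : nat) : -1 < a -> -1 < b ->
  (exists L, ImproperInt (weight (-1) 1 a b) (-1) 1 L) ->
  ImproperInt (fun y => Jacobi a b n y * Jacobi a b n y * weight (-1) 1 a b y) (-1) 1
    (jgamma a b n).
Proof.
  revert a b; induction n as [|n IH]; intros a b Ha Hb Hw.
  - destruct Hw as [L HL]. eapply ImproperInt_ext;
      [|eapply eq_rect; [exact HL|]].
    + intros y _. rewrite Jacobi_0 by exact Ha. ring.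
    + rewrite (ImproperInt_weight_Beta (-1) 1 a b L ltac:(lra) Ha Hb HL). unfold jgamma.
      replace (1 - -1) with 2 by ring. reflexivity.
  - assert (Hw' : exists L, ImproperInt (weight (-1) 1 (a + 1) (b + 1)) (-1) 1 L).
    { destruct (ImproperInt_poly_weight a b 2 (fun y => 1 - y ^ 2) Ha Hb Hw) as [L HL].
      - exists (fun k => match k with O => 1 | 1%nat => 0 | _ => -1 end). intros x; simpl; ring.
      - exists L. eapply ImproperInt_ext; [|exact HL]. intros y Hy. cbv beta.
        rewrite weight_succ_l, weight_succ_r by lra. ring. }
    assert (H1 := IH (a + 1) (b + 1) ltac:(lra) ltac:(lra) Hw').
    assert (H2 := ImproperInt_Sturm_Liouville a b (S n) (S n) Ha Hb).
    pose proof (pos_INR n).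
    assert (HS : 0 < INR (S n)) by (apply lt_0_INR; lia).
    assert (HS' : 0 < INR (S n) + a + b + 1) by (rewrite S_INR; lra).
    assert (H3 := ImproperInt_lin _ _ _ _ _ _
      ((INR (S n) + a + b + 1) / (4 * INR (S n))) (- / jacobi_eigen a b (S n)) H1 H2).
    rewrite jgamma_S by assumption.
    eapply ImproperInt_ext; [|eapply eq_rect; [exact H3|ring]].
    intros y Hy. cbv beta. rewrite dJacobi_S. unfold jacobi_eigen.
    rewrite weight_succ_l, weight_succ_r by lra. field. split; lra.
Qed.

(** * Gauss-Lobatto quadrature *)

Lemma JGL_nodes_increasing (a b : R) (N : nat) (xs ws : nat -> R) : JGL a b N xs ws ->
  forall i j, (i < j)%nat -> (j <= N)%nat -> xs i < xs j.
Proof.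
  intros [Hinc _] i j Hij; induction Hij as [|j Hij IH]; intros Hj; [apply Hinc; lia|].
  apply Rlt_trans with (xs j); [apply IH; lia|apply Hinc; lia].
Qed.

Lemma JGL_nodes_inj (a b : R) (N : nat) (xs ws : nat -> R) : JGL a b N xs ws ->
  forall i j, (i <= N)%nat -> (j <= N)%nat -> xs i = xs j -> i = j.
Proof.
  intros H i j Hi Hj E.
  destruct (lt_eq_lt_dec i j) as [[Hij|Hij]|Hij]; [|exact Hij|].
  - pose proof (JGL_nodes_increasing a b N xs ws H i j Hij Hj); lra.
  - pose proof (JGL_nodes_increasing a b N xs ws H j i Hij Hi); lra.
Qed.

Lemma JGL_node_zero (a b : R) (N : nat) (xs ws : nat -> R) : -1 < a -> JGL a b N xs ws ->
  forall j, (j <= N)%nat -> (1 - xs j ^ 2) * dJacobi a b N (xs j) = 0.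
Proof.
  intros Ha [_ [Hz _]] j Hj.
  destruct (proj2 (Hz (xs j)) (ex_intro _ j (conj Hj eq_refl))) as [d [Hd Hd0]].
  apply is_derive_Reals in Hd. apply is_derive_unique in Hd.
  assert (H := is_derive_Jacobi a b N (xs j) Ha). apply is_derive_unique in H.
  congruence.
Qed.

(** The nodes are specified only as an increasing list of all real zeros of (1 - y^2) P_N'. As -1 is
    such a zero, it remains to rule out smaller ones, which would be zeros of P_N'. *)
Lemma JGL_node_0 (a b : R) (N : nat) (xs ws : nat -> R) : (1 <= N)%nat -> -1 < a -> -1 < b ->
  JGL a b N xs ws -> xs O = -1.
Proof.
  intros HN Ha Hb H.
  assert (Hz := proj1 (proj2 H)).
  destruct (proj1 (Hz (-1))) as [j [Hj Ej]].
  { exists (dJacobi a b N (-1)); split; [apply is_derive_Reals, is_derive_Jacobi, Ha|ring]. }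
  assert (Hle : xs O <= -1).
  { rewrite Ej. destruct j as [|j]; [lra|].
    left. apply (JGL_nodes_increasing a b N xs ws H); lia. }
  destruct Hle as [Hlt|E]; [exfalso|exact E].
  assert (H0 := JGL_node_zero a b N xs ws Ha H O ltac:(lia)).
  destruct N as [|n]; [lia|]. rewrite dJacobi_S in H0.
  pose proof (pos_INR n).
  assert (Hne := Jacobi_neq_0_left (a + 1) (b + 1) n (xs O) ltac:(lra) ltac:(lra)
    ltac:(right; lra) Hlt).
  apply Rmult_integral in H0 as [H0|H0]; [nra|].
  apply Rmult_integral in H0 as [H0|H0]; [rewrite S_INR in H0; lra|contradiction].
Qed.

Lemma JGL_quadrature (a b : R) (N : nat) (xs ws : nat -> R) (phi : R -> R) :
  JGL a b N xs ws -> InPN (2 * N - 1) phi ->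
  ImproperInt (fun y => phi y * weight (-1) 1 a b y) (-1) 1
    (sum_f_R0 (fun j => phi (xs j) * ws j) N).
Proof.
  intros [_ [_ H]] Hphi. eapply ImproperInt_ext; [|apply H, Hphi].
  intros y _. cbv beta. unfold weight. replace (y - -1) with (1 + y) by ring. ring.
Qed.

Lemma JGL_weight_integrable (a b : R) (N : nat) (xs ws : nat -> R) : JGL a b N xs ws ->
  exists L, ImproperInt (weight (-1) 1 a b) (-1) 1 L.
Proof.
  intros H. eexists. eapply ImproperInt_ext;
    [|apply (JGL_quadrature a b N xs ws (fun _ => 1) H), InPN_const].
  intros y _; simpl; ring.
Qed.

Lemma JGL_discrete_orthogonal (a b : R) (N : nat) (xs ws : nat -> R) (n m : nat) :
  -1 < a -> -1 < b -> JGL a b N xs ws -> (n <= N)%nat -> (m <= N)%nat -> n <> m ->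
  sum_f_R0 (fun j => Jacobi a b n (xs j) * Jacobi a b m (xs j) * ws j) N = 0.
Proof.
  intros Ha Hb H Hn Hm Hnm.
  apply (ImproperInt_unique (fun y => Jacobi a b n y * Jacobi a b m y * weight (-1) 1 a b y) (-1) 1);
    [lra| |apply ImproperInt_Jacobi_orthogonal; assumption].
  apply (JGL_quadrature a b N xs ws (fun y => Jacobi a b n y * Jacobi a b m y) H).
  apply (InPN_mono (n + m)); [lia|]. apply InPN_mul; apply InPN_Jacobi, Ha.
Qed.

(* For [n = N], replace [P_N^2] by [P_N^2 + (1 - x^2) P_N'^2 / N^2]: the two agree at the
   nodes, and the leading terms cancel, so the quadrature is exact for the latter. *)
Lemma JGL_discrete_norm (a b : R) (N : nat) (xs ws : nat -> R) (n : nat) :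
  (1 <= N)%nat -> -1 < a -> -1 < b -> JGL a b N xs ws -> (n <= N)%nat ->
  sum_f_R0 (fun j => Jacobi a b n (xs j) * Jacobi a b n (xs j) * ws j) N
  = jgamma_tilde a b N n.
Proof.
  intros HN Ha Hb H Hn. assert (Hw := JGL_weight_integrable a b N xs ws H).
  unfold jgamma_tilde. destruct (Nat.eqb_spec n N) as [->|Hne].
  - assert (HN0 : 0 < INR N) by (apply lt_0_INR; lia).
    set (phi := fun y => Jacobi a b N y * Jacobi a b N y
                + / INR N ^ 2 * ((1 - y ^ 2) * (dJacobi a b N y * dJacobi a b N y))).
    transitivity (sum_f_R0 (fun j => phi (xs j) * ws j) N).
    { apply sum_eq; intros j Hj. unfold phi.
      rewrite <- (Rmult_assoc (1 - xs j ^ 2)), (JGL_node_zero a b N xs ws Ha H j Hj). ring. }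
    apply (ImproperInt_unique (fun y => phi y * weight (-1) 1 a b y) (-1) 1); [lra|..].
    + apply (JGL_quadrature a b N xs ws phi H).
      set (s := fun x => x * dJacobi a b N x - INR N * Jacobi a b N x).
      assert (Hs : InPN (N - 1) s) by (apply InPN_X_dJacobi; assumption).
      assert (HP := InPN_Jacobi a b N Ha). assert (HD := InPN_dJacobi a b N Ha).
      (* Substituting x P' = s + N P cancels the term N^2 P^2; each remaining product contains a
         factor of degree at most N - 1, hence has degree at most 2N - 1. *)
      eapply InPN_ext with (fun y => / INR N ^ 2 *
        (dJacobi a b N y * dJacobi a b N y + (-2 * INR N * (Jacobi a b N y * s y) + -1 * (s y * s y)))).
      * intros x. unfold phi, s. field. lra.
      * apply InPN_scal, InPN_plus; [|apply InPN_plus; apply InPN_scal].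
        -- eapply InPN_mono; [|apply (InPN_mul _ _ _ _ HD HD)]. lia.
        -- eapply InPN_mono; [|apply (InPN_mul _ _ _ _ HP Hs)]. lia.
        -- eapply InPN_mono; [|apply (InPN_mul _ _ _ _ Hs Hs)]. lia.
    + assert (H1 := ImproperInt_Jacobi_norm a b N Ha Hb Hw).
      assert (H2 := ImproperInt_Sturm_Liouville a b N N Ha Hb).
      eapply ImproperInt_ext; [|eapply eq_rect; [apply (ImproperInt_lin _ _ _ _ _ _
         (1 + / INR N ^ 2 * jacobi_eigen a b N) (/ INR N ^ 2) H1 H2)|]].
      * intros y _. cbv beta. unfold phi. ring.
      (* Here 1 + N(N+a+b+1)/N^2 = 2 + (a+b+1)/N, the correction factor of [jgamma_tilde] at n =
         N. *)
      * unfold jacobi_eigen. field. lra.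
  - apply (ImproperInt_unique (fun y => Jacobi a b n y * Jacobi a b n y * weight (-1) 1 a b y) (-1) 1);
      [lra| |apply ImproperInt_Jacobi_norm; assumption].
    apply (JGL_quadrature a b N xs ws (fun y => Jacobi a b n y * Jacobi a b n y) H).
    apply (InPN_mono (n + n)); [lia|]. apply InPN_mul; apply InPN_Jacobi, Ha.
Qed.

Lemma jgamma_tilde_neq_0 (a b : R) (N n : nat) : (1 <= N)%nat -> -1 < a -> -1 < b ->
  jgamma_tilde a b N n <> 0.
Proof.
  intros HN Ha Hb. unfold jgamma_tilde. destruct (Nat.eqb n N).
  - apply Rmult_integral_contrapositive_currified;
      [|apply Rgt_not_eq, jgamma_pos; assumption].
    pose proof (le_INR 1 N HN) as H1; simpl in H1.
    replace (2 + (a + b + 1) / INR N) with ((2 * INR N + a + b + 1) / INR N) by (field; lra).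
    apply Rgt_not_eq, Rdiv_lt_0_compat; lra.
  - apply Rgt_not_eq, jgamma_pos; assumption.
Qed.

Lemma t_coef_Lagrange (a b : R) (N : nat) (xs ws : nat -> R) (i j : nat) :
  (1 <= N)%nat -> -1 < a -> -1 < b -> JGL a b N xs ws -> (i <= N)%nat -> (j <= N)%nat ->
  sum_f_R0 (fun n => t_coef a b N xs ws n j * Jacobi a b n (xs i)) N
  = if Nat.eqb i j then 1 else 0.
Proof.
  intros HN Ha Hb H Hi Hj.
  destruct (Lagrange_basis_exists N j xs HN Hj (JGL_nodes_inj a b N xs ws H)) as [h [Hh Eh]].
  destruct (InPN_Jacobi_basis a b N h Ha Hb Hh) as [d Hd].
  rewrite <- (Eh i Hi), Hd. apply sum_eq; intros m Hm. f_equal. unfold t_coef.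
  assert (Hg := jgamma_tilde_neq_0 a b N m HN Ha Hb).
  (* The discrete inner product of [h] with P_m is computed twice: at the nodes [h] is a Kronecker
     delta, and in the Jacobi expansion of [h] only the m-th term survives. *)
  assert (E : ws j * Jacobi a b m (xs j) = d m * jgamma_tilde a b N m).
  { transitivity (sum_f_R0 (fun i => h (xs i) * Jacobi a b m (xs i) * ws i) N).
    - rewrite (sum_f_R0_single _ N j Hj).
      + rewrite (Eh j Hj), Nat.eqb_refl. ring.
      + intros k Hk Hkj. rewrite (Eh k Hk). destruct (Nat.eqb_spec k j); [contradiction|ring].
    - transitivity (sum_f_R0 (fun i => sum_f_R0 (fun n =>
        d n * (Jacobi a b n (xs i) * Jacobi a b m (xs i) * ws i)) N) N).
      + apply sum_eq; intros k Hk. rewrite Hd, Rmult_assoc, Rmult_comm, sum_f_R0_scal.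
        apply sum_eq; intros; ring.
      + rewrite sum_f_R0_exchange.
        rewrite (sum_f_R0_single _ N m Hm).
        * rewrite <- sum_f_R0_scal, (JGL_discrete_norm a b N xs ws m) by assumption. reflexivity.
        * intros n Hn Hnm. rewrite <- sum_f_R0_scal.
          rewrite (JGL_discrete_orthogonal a b N xs ws n m) by assumption. ring. }
  transitivity (ws j * Jacobi a b m (xs j) / jgamma_tilde a b N m); [field; exact Hg|].
  rewrite E. field. exact Hg.
Qed.

(** * Fractional derivatives of polynomials *)

(** Against a power of 1 + y the kernel becomes a weight on (-1, x) with exponents -mu and k, an
    integral already in closed form. *)
Lemma FracInt_poly (mu : R) (n : nat) (c : nat -> R) (u : R -> R) (x : R) :
  0 < mu < 1 -> -1 < x -> (forall y, u y = sum_f_R0 (fun k => c k * (1 + y) ^ k) n) ->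
  FracInt (1 - mu) u x (sum_f_R0 (fun k => c k * (INR (fact k) / Gamma (INR k + 2 - mu)
                                            * Rpower (1 + x) (INR k + 1 - mu))) n).
Proof.
  intros Hmu Hx Hu.
  set (J := fun k => Rpower (x - -1) (- mu + 1 + INR k) * INR (fact k) / poch (- mu + 1) (S k)).
  exists (sum_f_R0 (fun k => c k * J k) n); split.
  - apply ImproperInt_ext with (fun y => sum_f_R0 (fun k => c k * weight (-1) x (- mu) (INR k) y) n).
    + intros y Hy. rewrite Hu, sum_f_R0_scal. apply sum_eq; intros k _. unfold weight.
      replace (1 - mu - 1) with (- mu) by ring. rewrite Rpower_pow by lra.
      replace (y - -1) with (1 + y) by ring. ring.
    + clear Hu.
      assert (HJ : forall k, ImproperInt (weight (-1) x (- mu) (INR k)) (-1) x (J k))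
        by (intros k; apply ImproperInt_weight_INR_r; lra).
      induction n as [|n IH].
      * apply ImproperInt_scal, HJ.
      * eapply ImproperInt_ext; [|eapply eq_rect;
          [apply (ImproperInt_lin _ _ _ _ _ _ 1 (c (S n)) IH (HJ (S n)))|]].
        -- intros y _; rewrite tech5; ring.
        -- rewrite tech5; ring.
  - unfold Rdiv at 2. rewrite Rmult_comm, sum_f_R0_scal. apply sum_eq; intros k _.
    unfold J. replace (INR k + 2 - mu) with (1 - mu + INR (S k)) by (rewrite S_INR; ring).
    rewrite Gamma_add_INR by lra.
    replace (- mu + 1) with (1 - mu) by ring. replace (x - -1) with (1 + x) by ring.
    replace (1 - mu + INR k) with (INR k + 1 - mu) by ring.
    pose proof (poch_pos (1 - mu) (S k) ltac:(lra)). pose proof (Gamma_pos (1 - mu) ltac:(lra)).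
    field. split; lra.
Qed.

(** Differentiation lowers the Gamma argument by one and leaves the power k - mu; the factor (1 +
    x)^mu restores the integer power. *)
Lemma RLhatD_poly (mu : R) (n : nat) (c : nat -> R) (u : R -> R) (x : R) :
  0 < mu < 1 -> -1 < x -> (forall y, u y = sum_f_R0 (fun k => c k * (1 + y) ^ k) n) ->
  RLhatD mu u x
    (sum_f_R0 (fun k => c k * (INR (fact k) / Gamma (INR k + 1 - mu)) * (1 + x) ^ k) n).
Proof.
  intros Hmu Hx Hu.
  eexists. split; [intros y Hy; apply (FracInt_poly mu n c u y Hmu Hy Hu)|].
  exists (sum_f_R0 (fun k => c k * (INR (fact k) / Gamma (INR k + 1 - mu)
                                     * Rpower (1 + x) (INR k - mu))) n).
  split.
  - apply is_derive_Reals. apply is_derive_sum_f_R0. intros k _. pose proof (pos_INR k).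
    apply is_derive_scal.
    assert (H1 := is_derive_Rpower_affine 1 1 (INR k + 1 - mu) x ltac:(lra)).
    apply (is_derive_scal _ _ (INR (fact k) / Gamma (INR k + 2 - mu))) in H1.
    eapply is_derive_ext; [|eapply eq_rect; [exact H1|]].
    + intros t; simpl. do 2 f_equal; ring.
    + replace (INR k + 2 - mu) with (INR k + 1 - mu + 1) by ring.
      rewrite Gamma_succ by lra. replace (1 * x + 1) with (1 + x) by ring.
      replace (INR k + 1 - mu - 1) with (INR k - mu) by ring.
      pose proof (Gamma_pos (INR k + 1 - mu) ltac:(lra)). simpl. field. split; lra.
  - rewrite sum_f_R0_scal. apply sum_eq; intros k _.
    replace ((1 + x) ^ k) with (Rpower (1 + x) mu * Rpower (1 + x) (INR k - mu)); [ring|].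
    rewrite <- Rpower_plus, <- Rpower_pow by lra. f_equal; ring.
Qed.

(** The function [F] is existentially quantified, but two choices agree for all y > -1, a
    neighbourhood of x, and so have the same derivative there. *)
Lemma RLhatD_unique (mu : R) (u : R -> R) (x d d' : R) :
  -1 < x -> RLhatD mu u x d -> RLhatD mu u x d' -> d = d'.
Proof.
  intros Hx [F [HF [l [Hl ->]]]] [F' [HF' [l' [Hl' ->]]]]. f_equal.
  apply is_derive_Reals in Hl, Hl'.
  assert (E : locally x (fun y => F y = F' y)).
  { assert (Hd : 0 < x + 1) by lra. exists (mkposreal _ Hd). intros y Hy.
    apply Rabs_def2 in Hy. unfold minus, plus, opp in Hy; simpl in Hy.
    destruct (HF y ltac:(lra)) as [I [HI ->]]. destruct (HF' y ltac:(lra)) as [I' [HI' ->]].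
    f_equal. eapply ImproperInt_unique; [|exact HI|exact HI']. lra. }
  apply (is_derive_ext_loc _ _ _ _ E) in Hl.
  apply is_derive_unique in Hl, Hl'. congruence.
Qed.

(** * The operator as a diagonal map on polynomials *)

(** The graph of the operator on polynomials, expressed by coefficients at -1. In contrast to
    [RLhatD_poly], where -1 < x, it assigns the image a value at the node -1 as well. *)
Definition frac_pair (mu : R) (n : nat) (u v : R -> R) : Prop :=
  exists c : nat -> R,
    (forall x, u x = sum_f_R0 (fun k => c k * (1 + x) ^ k) n) /\
    (forall x, v x = sum_f_R0
       (fun k => c k * (INR (fact k) / Gamma (INR k + 1 - mu)) * (1 + x) ^ k) n).

Lemma frac_pair_RLhatD (mu : R) (n : nat) (u v : R -> R) (x : R) :
  0 < mu < 1 -> -1 < x -> frac_pair mu n u v -> RLhatD mu u x (v x).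
Proof. intros Hmu Hx [c [Hu Hv]]. rewrite Hv. apply RLhatD_poly; assumption. Qed.

Lemma frac_pair_at_m1 (mu : R) (n : nat) (u v : R -> R) :
  0 < mu < 1 -> frac_pair mu n u v -> u (-1) = Gamma (1 - mu) * v (-1).
Proof.
  intros Hmu [c [Hu Hv]]. rewrite Hu, Hv.
  assert (Z : forall k, k <> O -> (1 + -1) ^ k = 0).
  { intros k Hk. replace (1 + -1) with 0 by ring. apply pow_i; lia. }
  rewrite !(sum_f_R0_single _ n 0) by (try lia; intros k _ Hk; rewrite Z by exact Hk; ring).
  simpl. replace (0 + 1 - mu) with (1 - mu) by ring.
  pose proof (Gamma_pos (1 - mu) ltac:(lra)). field. lra.
Qed.

Lemma frac_pair_scal (mu : R) (n : nat) (s : R) (u v : R -> R) :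
  frac_pair mu n u v -> frac_pair mu n (fun x => s * u x) (fun x => s * v x).
Proof.
  intros [c [Hu Hv]]. exists (fun k => s * c k).
  split; intros x; [rewrite Hu|rewrite Hv]; rewrite sum_f_R0_scal; apply sum_eq; intros; ring.
Qed.

Lemma frac_pair_plus (mu : R) (n : nat) (u v u' v' : R -> R) :
  frac_pair mu n u v -> frac_pair mu n u' v' ->
  frac_pair mu n (fun x => u x + u' x) (fun x => v x + v' x).
Proof.
  intros [c [Hu Hv]] [c' [Hu' Hv']]. exists (fun k => c k + c' k).
  split; intros x; [rewrite Hu, Hu'|rewrite Hv, Hv']; rewrite <- plus_sum;
    apply sum_eq; intros; ring.
Qed.

Lemma frac_pair_sum (mu : R) (n m : nat) (u v : nat -> R -> R) :
  (forall l, (l <= m)%nat -> frac_pair mu n (u l) (v l)) ->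
  frac_pair mu n (fun x => sum_f_R0 (fun l => u l x) m) (fun x => sum_f_R0 (fun l => v l x) m).
Proof.
  intros H; induction m as [|m IH]; simpl; [apply H; lia|].
  apply frac_pair_plus; [apply IH; intros; apply H; lia|apply H; lia].
Qed.

Lemma frac_pair_ext (mu : R) (n : nat) (u v v' : R -> R) :
  (forall x, v x = v' x) -> frac_pair mu n u v -> frac_pair mu n u v'.
Proof. intros E [c [Hu Hv]]. exists c; split; [exact Hu|]. intros x; rewrite <- E; apply Hv. Qed.

Lemma frac_pair_InPN_l (mu : R) (n : nat) (u v : R -> R) : frac_pair mu n u v -> InPN n u.
Proof.
  intros [c [Hu _]]. eapply InPN_ext; [intros x; symmetry; apply Hu|].
  apply InPN_sum. intros k Hk. apply InPN_scal, (InPN_mono k); [exact Hk|].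
  eapply InPN_ext; [|apply (InPN_affine_pow 1 1 k)]. intros x; simpl; f_equal; ring.
Qed.

Lemma frac_pair_exists (mu : R) (n : nat) (u : R -> R) :
  InPN n u -> exists v, frac_pair mu n u v.
Proof.
  (* The coefficients of u(x - 1) in powers of x are those of u in powers of 1 + x. *)
  intros Hu. destruct (InPN_comp_affine n 1 (-1) u Hu) as [c Hc].
  eexists. exists c. split; [|intros x; reflexivity].
  intros x. rewrite <- (Hc (1 + x)). f_equal; ring.
Qed.

(** The n + 1 values determine the image and with it its coefficients; the diagonal multipliers are
    positive, so the coefficients of the preimage are determined too. *)
Lemma frac_pair_inj (mu : R) (n : nat) (u v u' v' : R -> R) (xs : nat -> R) : 0 < mu < 1 ->
  frac_pair mu n u v -> frac_pair mu n u' v' ->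
  (forall i j, (i <= n)%nat -> (j <= n)%nat -> xs i = xs j -> i = j) ->
  (forall i, (i <= n)%nat -> v (xs i) = v' (xs i)) -> forall x, u x = u' x.
Proof.
  intros Hmu [c [Hu Hv]] [c' [Hu' Hv']] Hinj Hvv x.
  set (g := fun k => INR (fact k) / Gamma (INR k + 1 - mu)).
  assert (Hg : forall k, 0 < g k).
  { intros k. pose proof (pos_INR k).
    apply Rdiv_lt_0_compat; [apply INR_fact_lt_0|apply Gamma_pos; lra]. }
  assert (H0 : forall y, sum_f_R0 (fun k => (c k - c' k) * g k * y ^ k) n = 0).
  { apply (InPN_roots n _ (fun i => 1 + xs i)).
    - exists (fun k => (c k - c' k) * g k); reflexivity.
    - intros i j Hi Hj E; apply Hinj; [exact Hi|exact Hj|lra].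
    - intros i Hi. specialize (Hvv i Hi). rewrite Hv, Hv' in Hvv.
      apply Rminus_diag_eq in Hvv. rewrite <- Hvv, <- minus_sum.
      apply sum_eq; intros k _; fold (g k); ring. }
  rewrite Hu, Hu'. apply sum_eq; intros k Hk. f_equal.
  assert (E := poly_zero_coef n _ H0 k Hk). cbv beta in E.
  apply Rmult_integral in E as [E|E]; [lra|]. specialize (Hg k); lra.
Qed.

(** Parameters of sum zero leave the upper hypergeometric parameters -l and l + 1 unchanged. Up to a
    constant, the multiplier only replaces (1)_k by (1 - mu)_k in the denominators of the expansion
    at -1, which is the passage from (0, 0) to (mu, -mu). *)
Lemma frac_pair_Legendre (mu : R) (l n : nat) : 0 < mu < 1 -> (l <= n)%nat ->
  frac_pair mu n (Legendre l)
    (fun x => INR (fact l) / Gamma (INR l - mu + 1) * Jacobi mu (- mu) l x).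
Proof.
  intros Hmu Hl.
  assert (Hz : forall a b k, (l < k)%nat -> jacobi_coef a b l k = 0).
  { intros a b k Hk. unfold jacobi_coef. rewrite poch_opp_INR_0 by exact Hk.
    unfold Rdiv. ring. }
  exists (fun k => (-1) ^ l * jacobi_coef 0 0 l k / 2 ^ k). split; intros x.
  - unfold Legendre. rewrite Jacobi_sum_m1 by lra. symmetry. apply sum_f_R0_trunc; [exact Hl|].
    intros k Hk. rewrite Hz by exact Hk. unfold Rdiv; ring.
  - rewrite Jacobi_sum_m1, sum_f_R0_scal by lra.
    rewrite (sum_f_R0_trunc _ l n Hl).
    + apply sum_eq; intros k _. unfold jacobi_coef.
      replace (INR l - mu + 1) with (1 - mu + INR l) by ring.
      replace (INR k + 1 - mu) with (1 - mu + INR k) by ring.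
      rewrite !Gamma_add_INR by lra. rewrite Rplus_0_l, !poch_1.
      replace (- mu + 1) with (1 - mu) by ring.
      replace (INR l + - mu + mu + 1) with (INR l + 0 + 0 + 1) by ring.
      pose proof (INR_fact_lt_0 l). pose proof (INR_fact_lt_0 k).
      pose proof (poch_pos (1 - mu) k ltac:(lra)). pose proof (poch_pos (1 - mu) l ltac:(lra)).
      pose proof (Gamma_pos (1 - mu) ltac:(lra)). pose proof (pow_lt 2 k ltac:(lra)).
      field. repeat split; lra.
    + intros k Hk. rewrite Hz by exact Hk. unfold Rdiv; ring.
Qed.

(** * Change of basis by connection coefficients *)

Lemma sum_f_R0_triangle (f : nat -> nat -> R) (N : nat) :
  sum_f_R0 (fun n => sum_f_R0 (fun l => f l n) n) N
  = sum_f_R0 (fun l => sum_f_R0 (fun k => f l (l + k)%nat) (N - l)) N.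
Proof.
  induction N as [|N IH]; [reflexivity|].
  rewrite !tech5, IH, Nat.sub_diag, <- Rplus_assoc, <- plus_sum. f_equal.
  - apply sum_eq; intros l Hl. replace (S N - l)%nat with (S (N - l)) by lia.
    rewrite tech5. f_equal. f_equal. lia.
  - simpl. f_equal. lia.
Qed.

Lemma that_coef_sum (a b mu : R) (N : nat) (xs ws : nat -> R) (C : nat -> nat -> R)
  (j : nat) (x : R) : IsConn a b mu (- mu) N C ->
  sum_f_R0 (fun l => that_coef a b N xs ws C l j * Jacobi mu (- mu) l x) N
  = sum_f_R0 (fun n => t_coef a b N xs ws n j * Jacobi a b n x) N.
Proof.
  intros HC.
  transitivity (sum_f_R0 (fun n => sum_f_R0 (fun l =>
    C l n * t_coef a b N xs ws n j * Jacobi mu (- mu) l x) n) N).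
  - rewrite sum_f_R0_triangle. apply sum_eq; intros l Hl. unfold that_coef.
    rewrite Rmult_comm, sum_f_R0_scal. apply sum_eq; intros; ring.
  - apply sum_eq; intros n Hn. rewrite (HC n Hn), sum_f_R0_scal. apply sum_eq; intros; ring.
Qed.

(** The factor Gamma(l - mu + 1)/l! in [Qhat] is the inverse of the constant picked up by the l-th
    Legendre polynomial, so the image is the plain expansion with coefficients [that_coef]. *)
Lemma frac_pair_Qhat (a b mu : R) (N : nat) (xs ws : nat -> R) (C : nat -> nat -> R) (j : nat) :
  0 < mu < 1 -> IsConn a b mu (- mu) N C ->
  frac_pair mu N (Qhat a b mu N xs ws C j)
    (fun x => zeta mu j * sum_f_R0 (fun n => t_coef a b N xs ws n j * Jacobi a b n x) N).
Proof.
  intros Hmu HC. apply frac_pair_scal.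
  apply frac_pair_ext with (fun x => sum_f_R0 (fun l =>
    Gamma (INR l - mu + 1) / INR (fact l) * that_coef a b N xs ws C l j
    * (INR (fact l) / Gamma (INR l - mu + 1) * Jacobi mu (- mu) l x)) N).
  - intros x. rewrite <- (that_coef_sum a b mu N xs ws C j x HC). apply sum_eq; intros l _.
    pose proof (INR_fact_lt_0 l). pose proof (pos_INR l).
    pose proof (Gamma_pos (INR l - mu + 1) ltac:(lra)). field. split; lra.
  - apply frac_pair_sum. intros l Hl. apply frac_pair_scal, frac_pair_Legendre; assumption.
Qed.

Theorem theorem5p2 (N : nat) (a b mu : R) (xs ws : nat -> R) (C : nat -> nat -> R) :
  (1 <= N)%nat -> -1 < a -> -1 < b -> 0 < mu < 1 ->
  JGL a b N xs ws -> IsConn a b mu (- mu) N C ->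
  forall j, (j <= N)%nat ->
    InPN N (Qhat a b mu N xs ws C j) /\
    QhatCond mu N xs j (Qhat a b mu N xs ws C j) /\
    (forall Q, InPN N Q -> QhatCond mu N xs j Q ->
       forall x, Q x = Qhat a b mu N xs ws C j x).
Proof.
  intros HN Ha Hb Hmu HJ HC j Hj.
  assert (HQ := frac_pair_Qhat a b mu N xs ws C j Hmu HC).
  set (v := fun x => zeta mu j * sum_f_R0 (fun n => t_coef a b N xs ws n j * Jacobi a b n x) N)
    in HQ.
  assert (Hv : forall i, (i <= N)%nat -> v (xs i) = zeta mu j * (if Nat.eqb i j then 1 else 0)).
  { intros i Hi. unfold v. rewrite t_coef_Lagrange by assumption. reflexivity. }
  assert (Hx0 := JGL_node_0 a b N xs ws HN Ha Hb HJ).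
  assert (Hxi : forall i, (1 <= i <= N)%nat -> -1 < xs i).
  { intros i Hi. rewrite <- Hx0. apply (JGL_nodes_increasing a b N xs ws HJ); lia. }
  assert (HG := Gamma_pos (1 - mu) ltac:(lra)).
  assert (Hcond : QhatCond mu N xs j (Qhat a b mu N xs ws C j)).
  { split.
    - intros i Hi. eapply eq_rect;
        [apply (frac_pair_RLhatD mu N _ v (xs i) Hmu (Hxi i Hi) HQ)|].
      rewrite Hv by lia. destruct (Nat.eqb_spec i j) as [<-|]; [|ring].
      destruct i as [|i]; [lia|]. simpl; ring.
    (* For j = 0 the factor [Gamma (1 - mu)] cancels against [zeta mu 0]. *)
    - rewrite (frac_pair_at_m1 mu N _ v Hmu HQ), <- Hx0, Hv by lia.
      destruct j as [|j]; simpl; [field; lra|ring]. }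
  split; [apply (frac_pair_InPN_l mu N _ v HQ)|]. split; [exact Hcond|].
  intros Q HQN [HQ1 HQ2]. destruct Hcond as [HC1 HC2].
  destruct (frac_pair_exists mu N Q HQN) as [q Hq].
  apply (frac_pair_inj mu N Q q _ v xs Hmu Hq HQ (JGL_nodes_inj a b N xs ws HJ)).
  (* The two image polynomials are compared at every node: at -1 through the prescribed values of
     the preimages, at the others through uniqueness of the fractional derivative. *)
  intros i Hi. destruct i as [|i].
  - apply Rmult_eq_reg_l with (Gamma (1 - mu)); [|lra].
    rewrite Hx0, <- (frac_pair_at_m1 mu N Q q Hmu Hq), <- (frac_pair_at_m1 mu N _ v Hmu HQ).
    rewrite HQ2, HC2; reflexivity.
  - assert (Hi' : (1 <= S i <= N)%nat) by lia.
    transitivity (if Nat.eqb (S i) j then 1 else 0).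
    + apply (RLhatD_unique mu Q (xs (S i))); [apply Hxi, Hi'| |apply HQ1, Hi'].
      apply (frac_pair_RLhatD mu N); [exact Hmu|apply Hxi, Hi'|exact Hq].
    + apply (RLhatD_unique mu (Qhat a b mu N xs ws C j) (xs (S i)));
        [apply Hxi, Hi'|apply HC1, Hi'|].
      apply (frac_pair_RLhatD mu N); [exact Hmu|apply Hxi, Hi'|exact HQ].
Qed.
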